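(* Let $S$ be a Noetherian scheme and let $(C,\mathcal A)$ be a ribbon over $S$ whose sheaf $\mathcal A$ satisfies condition $( ** )$. Let $\mathcal N$ be a torsion free sheaf of rank $r$ on the ribbon $(C,\mathcal A)$ such that $\mathcal N_0/\mathcal N_1$ is a locally free sheaf on $C$. Then $\mathcal N$ is a locally free sheaf of rank $r$ on the ribbon $(C,\mathcal A)$, i.e. $C$ is covered by open sets $V$ with $\mathcal N|_V\simeq \mathcal A^{\oplus r}|_V$ as sheaves of $\mathcal A|_V$-modules.
   Context: A ribbon $(C,\mathcal A)$ over a Noetherian scheme $S$ consists of: a flat family of reduced algebraic curves $\tau:C\to S$; a sheaf $\mathcal A$ of commutative $\tau^{-1}\mathcal O_S$-algebras on $C$; a descending filtration $(\mathcal A_i)_{i\in\mathbb Z}$ of $\mathcal A$ by $\tau^{-1}\mathcal O_S$-submodules such that (i) $\mathcal A_i\mathcal A_j\subset\mathcal A_{i+j}$ and $1\in\mathcal A_0$; (ii) $\mathcal A_0/\mathcal A_1=\mathcal O_C$; (iii) for each $i$ the sheaf $\mathcal A_i/\mathcal A_{i+1}$ is a coherent sheaf on $C$, flat over $S$, and for any $s\in S$ its restriction to the fibre $C_s$ has no nonzero coherent subsheaf with finite support and is isomorphic to $\mathcal O_{C_s}$ on a dense open set; (iv) $\mathcal A=\varinjlim_{i}\mathcal A_i$, and $\mathcal A_i=\varprojlim_{j>0}\mathcal A_i/\mathcal A_{i+j}$ for each $i$. A torsion free sheaf of rank $r$ on $(C,\mathcal A)$ is a sheaf $\mathcal N$ of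 $\mathcal A$-modules on $C$ with a descending filtration $(\mathcal N_i)_{i\in\mathbb Z}$ by $\mathcal A_0$-submodules such that: $\mathcal N_i\mathcal A_j\subseteq\mathcal N_{i+j}$ for all $i,j$; for each $i$ the sheaf $\mathcal N_i/\mathcal N_{i+1}$ is a coherent sheaf on $C$, flat over $S$, and for any $s\in S$ its restriction to $C_s$ has no nonzero coherent subsheaf with finite support and is isomorphic to $\mathcal O_{C_s}^{\oplus r}$ on a dense open set; $\mathcal N=\varinjlim_i\mathcal N_i$ and $\mathcal N_i=\varprojlim_{j>0}\mathcal N_i/\mathcal N_{i+j}$ for each $i$. Condition $( ** )$ on $\mathcal A$: there is an affine open cover $\{U_\alpha\}_{\alpha\in I}$ of $C$ such that for every $\alpha\in I$ there is a section $a\in\mathcal A_1(U_\alpha)\subset\mathcal A(U_\alpha)$, invertible in $\mathcal A(U_\alpha)$, with $a^{-1}\in\mathcal A_{-1}(U_\alpha)$. *)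

(* Defs.v *)
From HB Require Import structures.
From mathcomp Require Import all_boot all_order all_algebra.
From mathcomp Require Import boolp classical_sets cardinality topology.

Set Implicit Arguments.
Unset Strict Implicit.
Unset Printing Implicit Defensive.

Import GRing.Theory.
Local Open Scope classical_set_scope.
Local Open Scope ring_scope.
Local Open Scope quotient_scope.

Record opens (X : topologicalType) := Opens { oset :> set X; openP : open oset }.

Definition opensI (X : topologicalType) (U V : opens X) : opens X :=
  Opens (openI (openP U) (openP V)).

Lemma opensIl (X : topologicalType) (U V : opens X) : opensI U V `<=` U.
Proof. exact: subIsetl. Qed.

Lemma opensIr (X : topologicalType) (U V : opens X) : opensI U V `<=` V.
Proof. exact: subIsetr. Qed.

Definition preim_open (X Y : topologicalType) (f : X -> Y) (cf : continuous f)
    (V : opens Y) : opens X :=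
  Opens ((continuousP f).1 cf (oset V) (openP V)).

Definition is_sheaf (X : topologicalType) (F : opens X -> Type)
    (res : forall U V : opens X, V `<=` U -> F U -> F V) : Prop :=
  [/\ forall (U : opens X) (h : U `<=` U) (s : F U), res U U h s = s,
      forall (U V W : opens X) (hVU : V `<=` U) (hWV : W `<=` V)
        (hWU : W `<=` U) (s : F U),
        res V W hWV (res U V hVU s) = res U W hWU s
    & forall (I : Type) (V : I -> opens X) (U : opens X)
        (hV : forall i, V i `<=` U) (s : forall i, F (V i)),
        (forall x, oset U x -> exists i, oset (V i) x) ->
        (forall (i j : I) (W : opens X) (hi : W `<=` V i) (hj : W `<=` V j),
          res (V i) W hi (s i) = res (V j) W hj (s j)) ->
        exists! t : F U, forall i, res U (V i) (hV i) t = s i].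

Record abSheaf (X : topologicalType) := AbSheaf {
  asec :> opens X -> zmodType;
  ares : forall U V : opens X, V `<=` U -> {additive asec U -> asec V};
  asheafP : is_sheaf (fun U V h => ares h) }.

(* comPzRingType, and not comNzRingType: the sections over the empty set form
   the zero ring. *)
Record ringSheaf (X : topologicalType) := RingSheaf {
  rsec :> opens X -> comPzRingType;
  rres : forall U V : opens X, V `<=` U -> {rmorphism rsec U -> rsec V};
  rsheafP : is_sheaf (fun U V h => rres h) }.

Record modSheaf (X : topologicalType) (O : ringSheaf X) := ModSheaf {
  msec :> forall U : opens X, lmodType (O U);
  mres : forall U V : opens X, V `<=` U -> {additive msec U -> msec V};
  mresZ : forall (U V : opens X) (h : V `<=` U) (a : O U) (m : msec U),
    mres h (a *: m) = rres O h a *: mres h m;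
  msheafP : is_sheaf (fun U V h => mres h) }.

Arguments ares {X} a {U V} h.
Arguments rres {X} r {U V} h.
Arguments mres {X O} m0 {U V} h.

Coercion ab_of_ring (X : topologicalType) (O : ringSheaf X) : abSheaf X :=
  @AbSheaf X (fun U => O U) (fun U V h => rres O h) (rsheafP O).

Coercion ab_of_mod (X : topologicalType) (O : ringSheaf X) (F : modSheaf O) :
    abSheaf X :=
  @AbSheaf X (fun U => F U) (fun U V h => mres F h) (msheafP F).

Record abMorph (X : topologicalType) (F G : abSheaf X) := AbMorph {
  amap :> forall U : opens X, {additive F U -> G U};
  amap_nat : forall (U V : opens X) (h : V `<=` U) (s : F U),
    ares G h (amap U s) = amap V (ares F h s) }.

Record modMorph (X : topologicalType) (O : ringSheaf X) (F G : modSheaf O) :=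
  ModMorph {
    mmap :> forall U : opens X, {linear F U -> G U};
    mmap_nat : forall (U V : opens X) (h : V `<=` U) (s : F U),
      mres G h (mmap U s) = mmap V (mres F h s) }.

(* An isomorphism between the restrictions F|_V and G|_V. *)
Definition iso_on (X : topologicalType) (O : ringSheaf X) (V : set X)
    (F G : modSheaf O) : Prop :=
  exists phi : forall U : opens X, U `<=` V -> {linear F U -> G U},
    (forall (U : opens X) (h : U `<=` V), bijective (phi U h)) /\
    (forall (U W : opens X) (hU : U `<=` V) (hW : W `<=` V) (hWU : W `<=` U)
       (s : F U), mres G hWU (phi U hU s) = phi W hW (mres F hWU s)).

Section FreeModule.
Variables (X : topologicalType) (O : ringSheaf X) (n : nat).

Definition free_res (U V : opens X) (h : V `<=` U) (v : 'rV[O U]_n) :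
  'rV[O V]_n := map_mx (rres O h) v.

Lemma free_res_is_additive (U V : opens X) (h : V `<=` U) : zmod_morphism (free_res h).
Proof. by move=> u v; rewrite /free_res map_mxB. Qed.

HB.instance Definition _ (U V : opens X) (h : V `<=` U) :=
  GRing.isZmodMorphism.Build 'rV[O U]_n 'rV[O V]_n (free_res h)
    (free_res_is_additive h).

Lemma free_resZ (U V : opens X) (h : V `<=` U) (a : O U) (v : 'rV[O U]_n) :
  free_res h (a *: v) = rres O h a *: free_res h v.
Proof. by apply/rowP => i; rewrite !mxE rmorphM. Qed.

Lemma free_sheafP :
  @is_sheaf X (fun U => 'rV[O U]_n) (fun U V h => free_res h).
Proof.
have [rid rcomp rglue] := rsheafP O; split.
- by move=> U h s; apply/rowP => i; rewrite !mxE; apply: rid.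
- by move=> U V W h1 h2 h3 s; apply/rowP => i; rewrite !mxE; apply: rcomp.
move=> I V U hV s cov compat.
have glue k : exists t : O U, (forall i, rres O (hV i) t = s i 0 k) /\
    forall t', (forall i, rres O (hV i) t' = s i 0 k) -> t = t'.
  apply: (rglue I V U hV (fun i => s i 0 k) cov) => i j W hi hj.
  by have := congr1 (fun v : 'rV[O W]_n => v 0 k) (compat i j W hi hj); rewrite /= !mxE.
have [t tP] := choice glue.
exists (\row_k t k); split.
  by move=> i; apply/rowP => k; rewrite !mxE; rewrite (tP k).1.
move=> v vP; apply/rowP => k; rewrite !mxE; apply: (tP k).2 => i.
by have := congr1 (fun w : 'rV[O (V i)]_n => w 0 k) (vP i); rewrite /= !mxE.
Qed.

Definition free_mod : modSheaf O :=
  @ModSheaf X O (fun U => 'rV[O U]_n) (fun U V h => free_res h)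
    free_resZ free_sheafP.

End FreeModule.

Definition locally_free_of_rank (X : topologicalType) (O : ringSheaf X)
    (F : modSheaf O) (r : nat) : Prop :=
  forall x : X, exists2 V : opens X, oset V x & iso_on V F (free_mod O r).

Definition locally_free (X : topologicalType) (O : ringSheaf X)
    (F : modSheaf O) : Prop :=
  forall x : X, exists2 V : opens X, oset V x & exists n, iso_on V F (free_mod O n).

(* P is a submodule of F|_U0, given by its sections. *)
Definition finite_type_on (X : topologicalType) (O : ringSheaf X)
    (F : modSheaf O) (U0 : set X) (P : forall V : opens X, set (F V)) : Prop :=
  forall x, U0 x -> exists (V : opens X) (n : nat) (g : 'I_n -> F V),
    [/\ oset V x, V `<=` U0, forall i, P V (g i)
      & forall (W : opens X) (h : W `<=` V) (t : F W), P W t ->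
          forall y, oset W y -> exists (W' : opens X) (h' : W' `<=` W)
            (h'' : W' `<=` V) (c : 'I_n -> O W'),
            oset W' y /\ mres F h' t = \sum_i c i *: mres F h'' (g i)].

(* F is of finite type, and so is the kernel of every O^n|_U -> F|_U. *)
Definition coherent (X : topologicalType) (O : ringSheaf X) (F : modSheaf O) :
    Prop :=
  finite_type_on (F := F) setT (fun _ => setT) /\
  forall (U : opens X) (n : nat) (s : 'I_n -> F U),
    finite_type_on (F := free_mod O n) U
      (fun V => [set c : 'rV[O V]_n | exists h : V `<=` U,
                   \sum_i c 0 i *: mres F h (s i) = 0]).

Record subSheaf (X : topologicalType) (F : abSheaf X) := SubSheaf {
  smem :> forall U : opens X, set (F U);
  smem0 : forall U : opens X, @smem U 0;
  smemB : forall (U : opens X) (s t : F U),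
    @smem U s -> @smem U t -> @smem U (s - t);
  smem_res : forall (U V : opens X) (h : V `<=` U) (s : F U),
    @smem U s -> @smem V (ares F h s);
  smem_local : forall (U : opens X) (s : F U),
    (forall x, oset U x -> exists (V : opens X) (h : V `<=` U),
       oset V x /\ @smem V (ares F h s)) -> @smem U s }.

Arguments smem {X F} _ U _.

Section SubSheafSheaf.
Variables (X : topologicalType) (F : abSheaf X) (P : subSheaf F).

Definition smemb (U : opens X) : {pred F U} := fun s => `[< P U s >].

Lemma smemb_zmod U : zmod_closed (@smemb U).
Proof.
split; first by apply/asboolP; apply: smem0.
by move=> s t /asboolP Ps /asboolP Pt; apply/asboolP; apply: smemB.
Qed.

HB.instance Definition _ U := GRing.isZmodClosed.Build (F U) (@smemb U)
  (smemb_zmod U).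

Definition sub_sec (U : opens X) := {s : F U | s \in @smemb U}.
HB.instance Definition _ U := SubChoice.on (sub_sec U).
HB.instance Definition _ U := [SubChoice_isSubZmodule of sub_sec U by <:].

Lemma sub_secP U (s : sub_sec U) : P U (val s).
Proof. by apply/asboolP; apply: (valP s). Qed.

Lemma sub_res_subproof (U V : opens X) (h : V `<=` U) (s : sub_sec U) :
  ares F h (val s) \in @smemb V.
Proof. by apply/asboolP; apply/smem_res/sub_secP. Qed.

Definition sub_res (U V : opens X) (h : V `<=` U) (s : sub_sec U) : sub_sec V :=
  Sub (ares F h (val s)) (sub_res_subproof h s).

Lemma sub_res_is_additive (U V : opens X) (h : V `<=` U) : zmod_morphism (sub_res h).
Proof. by move=> s t; apply: val_inj; rewrite /= !raddfB. Qed.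

HB.instance Definition _ (U V : opens X) (h : V `<=` U) :=
  GRing.isZmodMorphism.Build (sub_sec U) (sub_sec V) (sub_res h)
    (sub_res_is_additive h).

Lemma sub_sheafP : @is_sheaf X sub_sec (fun U V h => sub_res h).
Proof.
have [rid rcomp rglue] := asheafP F; split.
- by move=> U h s; apply: val_inj; apply: rid.
- by move=> U V W h1 h2 h3 s; apply: val_inj; apply: rcomp.
move=> I V U hV s cov compat.
have [|t [tP tU]] := rglue I V U hV (fun i => val (s i)) cov.
  by move=> i j W hi hj; apply: (congr1 val (compat i j W hi hj)).
have Pt : t \in @smemb U.
  apply/asboolP; apply: smem_local => x /cov [i Vix].
  by exists (V i), (hV i); split=> //; rewrite tP; apply: sub_secP.
exists (Sub t Pt); split; first by move=> i; apply: val_inj; apply: tP.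
move=> t' t'P; apply: val_inj; apply: tU => i.
exact: (congr1 val (t'P i)).
Qed.

Definition sub_sheaf : abSheaf X :=
  @AbSheaf X sub_sec (fun U V h => sub_res h) sub_sheafP.

End SubSheafSheaf.

(* pi exhibits Q as the quotient sheaf P / J: it is an epimorphism of sheaves
   with kernel J.  This determines (Q, pi) up to unique isomorphism. *)
Definition is_quotient (X : topologicalType) (F : abSheaf X)
    (P J : subSheaf F) (Q : abSheaf X) (pi : abMorph (sub_sheaf P) Q) : Prop :=
  (forall (U : opens X) (s : sub_sec P U), pi U s = 0 <-> J U (val s)) /\
  (forall (U : opens X) (q : Q U) x, oset U x ->
     exists (V : opens X) (h : V `<=` U) (s : sub_sec P V),
       oset V x /\ pi V s = ares Q h q).

Record filtration (X : topologicalType) (F : abSheaf X) := Filtration {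
  fil :> int -> subSheaf F;
  fil_desc : forall (i : int) (U : opens X) (s : F U),
    fil (i + 1) U s -> fil i U s }.

(* F is the colimit of the subsheaves F_i, i.e. their union as sheaves. *)
Definition exhaustive (X : topologicalType) (F : abSheaf X)
    (Fi : filtration F) : Prop :=
  forall (U : opens X) (s : F U) x, oset U x ->
    exists (V : opens X) (h : V `<=` U) (i : int), oset V x /\ Fi i V (ares F h s).

(* F_i is the limit over j > 0 of the quotient sheaves Q_(j-1) = F_i / F_(i+j);
   limits of sheaves are computed on sections. *)
Definition complete_at (X : topologicalType) (F : abSheaf X)
    (Fi : filtration F) (i : int) : Prop :=
  exists (Q : nat -> abSheaf X)
    (pi : forall j, abMorph (sub_sheaf (Fi i)) (Q j))
    (tr : forall j, abMorph (Q j.+1) (Q j)),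
    [/\ forall j : nat, is_quotient (Fi (i + j.+1%:Z)) (pi j),
        forall j (U : opens X) (s : sub_sec (Fi i) U),
          tr j U (pi j.+1 U s) = pi j U s
      & forall (U : opens X) (q : forall j, Q j U),
          (forall j, tr j U (q j.+1) = q j) ->
          exists! s : sub_sec (Fi i) U, forall j, pi j U s = q j].

Section Stalk.
Variables (X : topologicalType) (F : abSheaf X) (x : X).

Record pregerm := PreGerm {
  pg_dom : opens X; pg_in : oset pg_dom x; pg_sec : F pg_dom }.

HB.instance Definition _ := gen_eqMixin pregerm.
HB.instance Definition _ := gen_choiceMixin pregerm.

Definition germ_eq (g h : pregerm) : Prop :=
  exists (W : opens X) (hg : W `<=` pg_dom g) (hh : W `<=` pg_dom h),
    oset W x /\ ares F hg (pg_sec g) = ares F hh (pg_sec h).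

Definition germ_eqb (g h : pregerm) : bool := `[< germ_eq g h >].

Lemma germ_eqb_refl : reflexive germ_eqb.
Proof.
case=> U Ux s; apply/asboolP.
by exists U, (@subset_refl _ U), (@subset_refl _ U).
Qed.

Lemma germ_eqb_sym : symmetric germ_eqb.
Proof.
move=> g h; apply/asboolP/asboolP => -[W [hg [hh [Wx e]]]];
by exists W, hh, hg.
Qed.

Lemma germ_eqb_trans : transitive germ_eqb.
Proof.
have [_ rcomp _] := asheafP F.
move=> h g k /asboolP [W [hg [hh [Wx e]]]] /asboolP [W' [hh' [hk [W'x e']]]].
apply/asboolP; exists (opensI W W').
have i1 : opensI W W' `<=` W by move=> y [].
have i2 : opensI W W' `<=` W' by move=> y [].
have jg := subset_trans i1 hg.
have jh := subset_trans i1 hh.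
have jk := subset_trans i2 hk.
exists jg, jk; split; first by split.
rewrite -(rcomp _ _ _ hg i1 jg) /= e (rcomp _ _ _ hh i1 jh).
by rewrite -(rcomp _ _ _ hh' i2 jh) /= e' (rcomp _ _ _ hk i2 jk).
Qed.

Canonical germ_equiv :=
  EquivRel germ_eqb germ_eqb_refl germ_eqb_sym germ_eqb_trans.

Definition stalk := {eq_quot germ_equiv}.

HB.instance Definition _ := Choice.on stalk.
HB.instance Definition _ := EqQuotient.on stalk.

Definition germ (U : opens X) (hx : oset U x) (s : F U) : stalk :=
  \pi_stalk (PreGerm hx s).

Lemma germP (U V : opens X) (hU : oset U x) (hV : oset V x) (s : F U) (t : F V) :
  germ hU s = germ hV t <->
  exists (W : opens X) (h1 : W `<=` U) (h2 : W `<=` V),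
    oset W x /\ ares F h1 s = ares F h2 t.
Proof.
by split=> [/eqmodP/asboolP //|e]; apply/eqmodP/asboolP.
Qed.

Lemma germ_res (U V : opens X) (hU : oset U x) (hV : oset V x) (h : V `<=` U) (s : F U) :
  germ hV (ares F h s) = germ hU s.
Proof.
have [_ rcomp _] := asheafP F.
by apply/germP; exists V, (@subset_refl _ V), h; split=> //; apply: rcomp.
Qed.

Lemma stalk_ind (a : stalk) :
  exists (U : opens X) (hx : oset U x) (s : F U), a = germ hx s.
Proof.
by rewrite -[a]reprK; case: (repr a) => U hx s; exists U, hx, s.
Qed.

End Stalk.

Section StalkZmod.
Variables (X : topologicalType).

(* Extends an operation on sections to germs, by computing it on
   representatives restricted to a common neighbourhood. *)
Definition stalk_op2 (F G H : abSheaf X)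
    (op : forall U : opens X, F U -> G U -> H U) (x : X)
    (a : stalk F x) (b : stalk G x) : stalk H x :=
  let g := repr a in let h := repr b in
  @germ X H x (opensI (pg_dom g) (pg_dom h)) (conj (pg_in g) (pg_in h))
    (op _ (ares F (@opensIl _ _ _) (pg_sec g))
          (ares G (@opensIr _ _ _) (pg_sec h))).

Arguments stalk_op2 {F G H} op {x} a b.

Lemma stalk_op2E (F G H : abSheaf X)
    (op : forall U : opens X, F U -> G U -> H U)
    (op_nat : forall (U V : opens X) (h : V `<=` U) s t,
       ares H h (op U s t) = op V (ares F h s) (ares G h t))
    (x : X) (U : opens X) (hx : oset U x) (s : F U) (t : G U) :
  stalk_op2 op (germ hx s) (germ hx t) = germ hx (op U s t).
Proof.
have [_ rF _] := asheafP F; have [_ rG _] := asheafP G.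
rewrite /stalk_op2.
have := reprK (germ hx s); have := reprK (germ hx t).
case: (repr (germ hx s)) (repr (germ hx t)) => [U1 x1 s1] [U2 x2 s2] /=.
move=> /germP [W2 [h2 [k2 [W2x e2]]]] /germP [W1 [h1 [k1 [W1x e1]]]].
apply/germP; exists (opensI W1 W2).
have i1 : opensI W1 W2 `<=` W1 by move=> y [].
have i2 : opensI W1 W2 `<=` W2 by move=> y [].
have j : opensI W1 W2 `<=` opensI U1 U2.
  by move=> y [y1 y2]; split; [exact: (h1 _ y1) | exact: (h2 _ y2)].
have k := subset_trans i1 k1.
have j1 := subset_trans i1 h1.
have j2 := subset_trans i2 h2.
exists j, k; split; first by split.
rewrite !op_nat (rF _ _ _ _ _ j1) (rG _ _ _ _ _ j2).
rewrite -(rF _ _ _ h1 i1 j1) /= e1 (rF _ _ _ k1 i1 k).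
by rewrite -(rG _ _ _ h2 i2 j2) /= e2 (rG _ _ _ k2 i2 k).
Qed.

Lemma stalk_ind2 (F G : abSheaf X) (x : X) (a : stalk F x) (b : stalk G x) :
  exists (U : opens X) (hx : oset U x) (s : F U) (t : G U),
    a = germ hx s /\ b = germ hx t.
Proof.
have [U [Ux [s ->]]] := stalk_ind a; have [V [Vx [t ->]]] := stalk_ind b.
have hU : opensI U V `<=` U by move=> y [].
have hV : opensI U V `<=` V by move=> y [].
have hx : oset (opensI U V) x by split.
by exists (opensI U V), hx, (ares F hU s), (ares G hV t); rewrite !germ_res.
Qed.

Lemma stalk_ind3 (F G H : abSheaf X) (x : X)
    (a : stalk F x) (b : stalk G x) (c : stalk H x) :
  exists (U : opens X) (hx : oset U x) (s : F U) (t : G U) (u : H U),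
    [/\ a = germ hx s, b = germ hx t & c = germ hx u].
Proof.
have [U [Ux [s [t [-> ->]]]]] := stalk_ind2 a b.
have [V [Vx [u ->]]] := stalk_ind c.
have hU : opensI U V `<=` U by move=> y [].
have hV : opensI U V `<=` V by move=> y [].
have hx : oset (opensI U V) x by split.
exists (opensI U V), hx, (ares F hU s), (ares G hU t), (ares H hV u).
by rewrite !germ_res.
Qed.

Variables (F : abSheaf X) (x : X).

Definition opensT : opens X := Opens (@openT X).

Definition stalk_zero : stalk F x := @germ X F x opensT I 0.
Definition stalk_add : stalk F x -> stalk F x -> stalk F x :=
  stalk_op2 (fun U (s t : F U) => s + t).
Definition stalk_opp (a : stalk F x) : stalk F x :=
  germ (pg_in (repr a)) (- pg_sec (repr a)).

Lemma germ0 U (hx : oset U x) : germ hx (0 : F U) = stalk_zero.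
Proof.
have hU : U `<=` opensT by [].
by rewrite /stalk_zero -(germ_res _ hx hU) raddf0.
Qed.

Lemma stalk_addE U (hx : oset U x) (s t : F U) :
  stalk_add (germ hx s) (germ hx t) = germ hx (s + t).
Proof. by apply: stalk_op2E => ? ? ? ? ?; rewrite raddfD. Qed.

Lemma stalk_oppE U (hx : oset U x) (s : F U) :
  stalk_opp (germ hx s) = germ hx (- s).
Proof.
rewrite /stalk_opp; have := reprK (germ hx s).
case: (repr (germ hx s)) => [V Vx t] /= /germP [W [h1 [h2 [Wx e]]]].
by apply/germP; exists W, h1, h2; rewrite !raddfN e.
Qed.

Lemma stalk_addA : associative stalk_add.
Proof.
move=> a b c; have [U [hx [s [t [u [-> -> ->]]]]]] := stalk_ind3 a b c.
by rewrite !stalk_addE addrA.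
Qed.

Lemma stalk_addC : commutative stalk_add.
Proof.
move=> a b; have [U [hx [s [t [-> ->]]]]] := stalk_ind2 a b.
by rewrite !stalk_addE addrC.
Qed.

Lemma stalk_add0 : left_id stalk_zero stalk_add.
Proof.
move=> a; have [U [hx [s ->]]] := stalk_ind a.
by rewrite -(germ0 hx) stalk_addE add0r.
Qed.

Lemma stalk_addN : left_inverse stalk_zero stalk_opp stalk_add.
Proof.
move=> a; have [U [hx [s ->]]] := stalk_ind a.
by rewrite stalk_oppE stalk_addE addNr germ0.
Qed.

HB.instance Definition _ := GRing.isZmodule.Build (stalk F x)
  stalk_addA stalk_addC stalk_add0 stalk_addN.

End StalkZmod.

Arguments stalk_op2 {X F G H} op {x} a b.

Section StalkRing.
Variables (X : topologicalType) (O : ringSheaf X) (x : X).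

Definition rstalk := stalk O x.
HB.instance Definition _ := GRing.Zmodule.on rstalk.

Definition rstalk_one : rstalk := @germ X O x (opensT X) I (1 : O (opensT X)).
Definition rstalk_mul : rstalk -> rstalk -> rstalk :=
  stalk_op2 (F := O) (G := O) (H := O) (fun U (s t : O U) => s * t).

Lemma germ1 U (hx : oset U x) : germ (F := O) hx (1 : O U) = rstalk_one.
Proof.
have hU : U `<=` opensT X by [].
by rewrite /rstalk_one -(germ_res (F := O) _ hx hU) /= rmorph1.
Qed.

Lemma rstalk_mulE U (hx : oset U x) (s t : O U) :
  rstalk_mul (germ (F := O) hx s) (germ (F := O) hx t) =
  germ (F := O) hx (s * t).
Proof. by apply: stalk_op2E => ? ? ? ? ?; rewrite /= rmorphM. Qed.

Lemma rstalk_mulA : associative rstalk_mul.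
Proof.
move=> a b c; have [U [hx [s [t [u [-> -> ->]]]]]] := stalk_ind3 a b c.
by rewrite !rstalk_mulE mulrA.
Qed.

Lemma rstalk_mulC : commutative rstalk_mul.
Proof.
move=> a b; have [U [hx [s [t [-> ->]]]]] := stalk_ind2 a b.
by rewrite !rstalk_mulE mulrC.
Qed.

Lemma rstalk_mul1 : left_id rstalk_one rstalk_mul.
Proof.
move=> a; have [U [hx [s ->]]] := stalk_ind a.
by rewrite -(germ1 hx) rstalk_mulE mul1r.
Qed.

Lemma rstalk_mulDl : left_distributive rstalk_mul (@stalk_add X O x).
Proof.
move=> a b c; have [U [hx [s [t [u [-> -> ->]]]]]] := stalk_ind3 a b c.
by rewrite !stalk_addE !rstalk_mulE stalk_addE mulrDl.
Qed.

HB.instance Definition _ := GRing.Zmodule_isComPzRing.Build rstalk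
  rstalk_mulA rstalk_mulC rstalk_mul1 rstalk_mulDl.

Variable F : modSheaf O.

Definition mstalk := stalk F x.
HB.instance Definition _ := GRing.Zmodule.on mstalk.

Definition mstalk_scale : rstalk -> mstalk -> mstalk :=
  stalk_op2 (F := O) (G := F) (H := F) (fun U (a : O U) (m : F U) => a *: m).

Lemma mstalk_scaleE U (hx : oset U x) (a : O U) (m : F U) :
  mstalk_scale (germ (F := O) hx a) (germ (F := F) hx m) =
  germ (F := F) hx (a *: m).
Proof. by apply: stalk_op2E => ? ? ? ? ?; rewrite /= mresZ. Qed.

Lemma mstalk_scaleA a b v :
  mstalk_scale a (mstalk_scale b v) = mstalk_scale (a * b) v.
Proof.
have [U [hx [s [t [u [-> -> ->]]]]]] := stalk_ind3 a b v.
by rewrite [_ * _]rstalk_mulE !mstalk_scaleE scalerA.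
Qed.

Lemma mstalk_scale1 : left_id 1 mstalk_scale.
Proof.
move=> v; have [U [hx [s ->]]] := stalk_ind v.
by rewrite -[1]/rstalk_one -(germ1 hx) mstalk_scaleE scale1r.
Qed.

Lemma mstalk_scaleDr : right_distributive mstalk_scale +%R.
Proof.
move=> a u v; have [U [hx [s [t [w [-> -> ->]]]]]] := stalk_ind3 a u v.
rewrite [X in mstalk_scale _ X](stalk_addE (F := F) hx t w) !mstalk_scaleE.
by rewrite [RHS](stalk_addE (F := F)) scalerDr.
Qed.

Lemma mstalk_scaleDl v : {morph mstalk_scale^~ v : a b / a + b}.
Proof.
move=> a b; have [U [hx [s [t [w [-> -> ->]]]]]] := stalk_ind3 a b v.
rewrite [X in mstalk_scale X _](stalk_addE (F := O) hx s t) !mstalk_scaleE.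
by rewrite [RHS](stalk_addE (F := F)) scalerDl.
Qed.

HB.instance Definition _ := GRing.Zmodule_isLmodule.Build rstalk mstalk
  mstalk_scaleA mstalk_scale1 mstalk_scaleDr mstalk_scaleDl.

End StalkRing.

Definition rgerm (X : topologicalType) (O : ringSheaf X) (x : X) (U : opens X)
    (hx : oset U x) (s : O U) : rstalk O x :=
  germ (F := O) hx s.

Definition mgerm (X : topologicalType) (O : ringSheaf X) (F : modSheaf O)
    (x : X) (U : opens X) (hx : oset U x) (s : F U) : mstalk x F :=
  germ (F := F) hx s.

Definition support (X : topologicalType) (O : ringSheaf X) (F : modSheaf O) :
    set X :=
  [set x | exists a : mstalk x F, a <> 0].

(* The map on stalks induced by a map of sheaves rho : F -> f_* G, i.e. by
   adjunction f^-1 F -> G. *)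
Definition pull_stalk (X Y : topologicalType) (f : X -> Y)
    (cf : continuous f) (F : abSheaf Y) (G : abSheaf X)
    (rho : forall V : opens Y, F V -> G (preim_open cf V)) (x : X)
    (a : stalk F (f x)) : stalk G x :=
  let g := repr a in
  @germ X G x (preim_open cf (pg_dom g)) (pg_in g) (rho _ (pg_sec g)).

Lemma pull_stalkE (X Y : topologicalType) (f : X -> Y)
    (cf : continuous f) (F : abSheaf Y) (G : abSheaf X)
    (rho : forall V : opens Y, F V -> G (preim_open cf V))
    (rho_nat : forall (U V : opens Y) (h : V `<=` U)
       (h' : preim_open cf V `<=` preim_open cf U) (s : F U),
       ares G h' (rho U s) = rho V (ares F h s))
    (x : X) (V : opens Y) (hx : oset V (f x)) (s : F V) :
  pull_stalk rho (germ hx s) = @germ X G x (preim_open cf V) hx (rho V s).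
Proof.
rewrite /pull_stalk; have := reprK (germ hx s).
case: (repr (germ hx s)) => [V' Vx t] /= /germP [W [h1 [h2 [Wx e]]]].
have p1 : preim_open cf W `<=` preim_open cf V' by move=> y; apply: h1.
have p2 : preim_open cf W `<=` preim_open cf V by move=> y; apply: h2.
apply/germP; exists (preim_open cf W), p1, p2; split=> //.
by rewrite (rho_nat _ _ h1) (rho_nat _ _ h2) e.
Qed.

Section CommutativeAlgebra.
Variable R : comPzRingType.

Definition invertible (a : R) : Prop := exists b, a * b = 1.

Definition is_ideal (I : set R) : Prop :=
  [/\ I 0, forall a b, I a -> I b -> I (a + b) & forall a b, I b -> I (a * b)].

Definition prime_ideal (I : set R) : Prop :=
  [/\ is_ideal I, ~ I 1 & forall a b, I (a * b) -> I a \/ I b].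

Definition maximal_ideal (I : set R) : Prop :=
  [/\ is_ideal I, ~ I 1
    & forall J, is_ideal J -> ~ J 1 -> I `<=` J -> J = I].

Definition local_ring : Prop := exists! m : set R, maximal_ideal m.

(* In a local ring this is the maximal ideal. *)
Definition nonunits : set R := [set a | ~ invertible a].

Definition noetherian_ring : Prop :=
  forall I : set R, is_ideal I ->
    exists (n : nat) (g : 'I_n -> R),
      forall a, I a <-> exists c : 'I_n -> R, a = \sum_i c i * g i.

End CommutativeAlgebra.

(* phi is the localization A -> A_f. *)
Definition is_localization (A B : comPzRingType) (phi : {rmorphism A -> B})
    (f : A) : Prop :=
  [/\ invertible (phi f),
      forall b : B, exists (n : nat) (a : A), phi f ^+ n * b = phi a
    & forall a : A, phi a = 0 -> exists n : nat, f ^+ n * a = 0].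

Definition fg_algebra (A B : comPzRingType) (phi : A -> B) : Prop :=
  exists (n : nat) (g : 'I_n -> B), forall P : set B,
    (forall a, P (phi a)) -> (forall i, P (g i)) ->
    (forall x y, P x -> P y -> P (x - y)) ->
    (forall x y, P x -> P y -> P (x * y)) -> forall b, P b.

Section ScalarsAlong.
Variables (R R' : comPzRingType) (phi : R -> R') (M : lmodType R').

(* \sum_i n_i (x) m_i = 0 in N (x)_R M, R acting on M through phi: by the
   universal property, every R-balanced biadditive map kills this sum. *)
Definition tensor_eq0 (N : lmodType R) (k : nat) (n : 'I_k -> N)
    (m : 'I_k -> M) : Prop :=
  forall (P : zmodType) (beta : N -> M -> P),
    (forall x x' y, beta (x + x') y = beta x y + beta x' y) ->
    (forall x y y', beta x (y + y') = beta x y + beta x y') ->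
    (forall a x y, beta (a *: x) y = beta x (phi a *: y)) ->
    \sum_i beta (n i) (m i) = 0.

(* M is a flat R-module: - (x)_R M preserves injectivity. *)
Definition flat_along : Prop :=
  forall (N' N : lmodType R) (u : {linear N' -> N}), injective u ->
    forall (k : nat) (n : 'I_k -> N') (m : 'I_k -> M),
      tensor_eq0 (fun i => u (n i)) m -> tensor_eq0 n m.

Definition extend_ideal (I : set R) : set M :=
  [set y | exists (k : nat) (b : 'I_k -> R) (m : 'I_k -> M),
             (forall i, I (b i)) /\ y = \sum_i phi (b i) *: m i].

End ScalarsAlong.

Record ringedSpace := RingedSpace {
  rs_top :> topologicalType;
  rs_O : ringSheaf rs_top }.

Record rsMorphism (X Y : ringedSpace) := RsMorphism {
  rs_map :> X -> Y;
  rs_cont : continuous rs_map;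
  rs_sharp : forall V : opens Y,
    {rmorphism rs_O Y V -> rs_O X (preim_open rs_cont V)};
  rs_sharp_nat : forall (U V : opens Y) (h : V `<=` U)
    (h' : preim_open rs_cont V `<=` preim_open rs_cont U) (s : rs_O Y U),
    rres (rs_O X) h' (rs_sharp U s) = rs_sharp V (rres (rs_O Y) h s) }.

Arguments rs_cont {X Y} r0 : rename.
Arguments rs_sharp {X Y} r0 V : rename.

Definition stalk_hom (X Y : ringedSpace) (f : rsMorphism X Y) (x : X) :
    rstalk (rs_O Y) (f x) -> rstalk (rs_O X) x :=
  @pull_stalk X Y f (rs_cont f) (rs_O Y) (rs_O X) (fun V => rs_sharp f V) x.

Definition locally_ringed (X : ringedSpace) : Prop :=
  forall x : X, local_ring (rstalk (rs_O X) x).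

Definition local_morphism (X Y : ringedSpace) (f : rsMorphism X Y) : Prop :=
  forall x a, @nonunits (rstalk (rs_O Y) (f x)) a ->
    @nonunits (rstalk (rs_O X) x) (stalk_hom a).

Section Affine.
Variables (X : ringedSpace) (U : opens X).
Local Notation O := (rs_O X).

(* D(f), the locus of U where f does not vanish. *)
Definition basic_locus (f : O U) : set X :=
  [set x | exists hx : oset U x, invertible (rgerm hx f)].

(* For X locally ringed: the canonical morphism U -> Spec O(U), sending x to
   the prime ideal of the sections vanishing at x, is an isomorphism.  That is,
   it is bijective; it is a homeomorphism (the D(f) are a basis of U); and it
   identifies O(D(f)) with the localization O(U)_f for every f. *)
Definition affine : Prop :=
  [/\ forall p : set (O U), prime_ideal p ->
        exists! x : X, oset U x /\ p = [set f | ~ basic_locus f x],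
      forall (V : opens X) x, V `<=` U -> oset V x ->
        exists f : O U, basic_locus f x /\ basic_locus f `<=` V
    & forall f : O U, exists (V : opens X) (h : V `<=` U),
        oset V = basic_locus f /\ is_localization (rres O h) f].

End Affine.

Definition is_scheme (X : ringedSpace) : Prop :=
  locally_ringed X /\
  forall x : X, exists2 U : opens X, oset U x & affine U.

Definition noetherian_scheme (X : ringedSpace) : Prop :=
  is_scheme X /\
  exists (n : nat) (U : 'I_n -> opens X),
    (forall x : X, exists i, oset (U i) x) /\
    (forall i, affine (U i) /\ noetherian_ring (rs_O X (U i))).

Definition finite_type_morphism (C S : ringedSpace) (tau : rsMorphism C S) :
    Prop :=
  forall s : S, exists V : opens S,
    [/\ oset V s, affine V
      & exists (n : nat) (U : 'I_n -> opens C),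
          (forall x : C, oset V (tau x) <-> exists i, oset (U i) x) /\
          (forall i, affine (U i) /\
             exists h : U i `<=` preim_open (rs_cont tau) V,
               fg_algebra (fun b => rres (rs_O C) h (rs_sharp tau V b)))].

Definition reduced (X : ringedSpace) : Prop :=
  forall (U : opens X) (f : rs_O X U) (n : nat), f ^+ n = 0 -> f = 0.

Definition irreducible_set (X : topologicalType) (Z : set X) : Prop :=
  Z !=set0 /\
  forall A B : set X, closed A -> closed B -> Z `<=` A `|` B ->
    Z `<=` A \/ Z `<=` B.

Definition irreducible_component (X : topologicalType) (Z : set X) : Prop :=
  irreducible_set Z /\
  forall Z' : set X, irreducible_set Z' -> Z `<=` Z' -> Z' = Z.

Definition has_chain (X : topologicalType) (Z : set X) (n : nat) : Prop :=
  exists c : nat -> set X,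
    (forall i, (i <= n)%N ->
       [/\ closed (c i), irreducible_set (c i) & c i `<=` Z]) /\
    (forall i, (i < n)%N -> c i `<` c i.+1).

Definition pure_dimension (X : topologicalType) (d : nat) : Prop :=
  forall Z : set X, irreducible_component Z ->
    has_chain Z d /\ ~ has_chain Z d.+1.

Section Fibres.
Variables (C S : ringedSpace) (tau : rsMorphism C S).

(* m_s F_x, where s = tau x. *)
Definition fibre_ideal (x : C) (M : lmodType (rstalk (rs_O C) x)) : set M :=
  extend_ideal (M := M) (@stalk_hom C S tau x)
    (@nonunits (rstalk (rs_O S) (tau x))).

(* The scheme theoretic fibre C_s = C x_S Spec k(s), with its projection
   i : C_s -> C: the space tau^-1(s) with the sheaf of rings
   i^-1 O_C (x)_(O_(S,s)) k(s) = i^-1 O_C / m_s i^-1 O_C.  It is determined up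
   to unique isomorphism. *)
Record fibre (s : S) := Fibre {
  fib :> ringedSpace;
  fib_incl : rsMorphism fib C;
  fib_inj : injective fib_incl;
  fib_im : range fib_incl = tau @^-1` [set s];
  fib_top : forall W : opens fib, exists U : opens C,
    oset W = fib_incl @^-1` oset U;
  fib_surj : forall (y : fib) (b : rstalk (rs_O fib) y),
    exists a, stalk_hom (f := fib_incl) a = b;
  fib_ker : forall (y : fib) (a : rstalk (rs_O C) (fib_incl y)),
    @stalk_hom _ _ fib_incl y a = 0 <->
    fibre_ideal (M := (rstalk (rs_O C) (fib_incl y))^o) a }.

(* The restriction of F to C_s, i.e. i^* F = i^-1 F / m_s i^-1 F, together
   with the canonical map F -> i_* i^* F. *)
Record fibre_restriction (s : S) (Y : fibre s) (F : modSheaf (rs_O C)) :=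
  FibreRestriction {
  fr_mod :> modSheaf (rs_O Y);
  fr_map : forall U : opens C,
    {additive F U -> fr_mod (preim_open (rs_cont (fib_incl Y)) U)};
  fr_nat : forall (U V : opens C) (h : V `<=` U)
    (h' : preim_open (rs_cont (fib_incl Y)) V `<=`
          preim_open (rs_cont (fib_incl Y)) U) (m : F U),
    mres fr_mod h' (fr_map U m) = fr_map V (mres F h m);
  fr_mapZ : forall (U : opens C) (a : rs_O C U) (m : F U),
    fr_map U (a *: m) = rs_sharp (fib_incl Y) U a *: fr_map U m;
  fr_surj : forall (y : Y) (b : mstalk y fr_mod),
    exists a : mstalk (fib_incl Y y) F,
      pull_stalk (F := F) (G := fr_mod) (fun U => fr_map U) a = b;
  fr_ker : forall (y : Y) (a : mstalk (fib_incl Y y) F),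
    pull_stalk (F := F) (G := fr_mod) (fun U => fr_map U) a = 0
      :> mstalk y fr_mod <->
    fibre_ideal (M := mstalk (fib_incl Y y) F) a }.

Definition flat_over (F : modSheaf (rs_O C)) : Prop :=
  forall x : C, flat_along (@stalk_hom C S tau x) (mstalk x F).

End Fibres.

(* A curve over a field is a scheme of finite type, all of whose irreducible
   components have dimension 1. *)
Record curve_family (S : ringedSpace) := CurveFamily {
  cf_C :> ringedSpace;
  cf_tau : rsMorphism cf_C S;
  cf_scheme : is_scheme cf_C;
  cf_local : local_morphism cf_tau;
  cf_ft : finite_type_morphism cf_tau;
  cf_flat : forall x : cf_C,
    flat_along (@stalk_hom _ _ cf_tau x) (rstalk (rs_O cf_C) x)^o;
  cf_fibre : forall s : S, fibre cf_tau s;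
  cf_reduced : forall s : S, reduced (cf_fibre s);
  cf_dim : forall s : S, pure_dimension (cf_fibre s) 1 }.

Definition torsion_free_module (Y : ringedSpace) (r : nat)
    (G : modSheaf (rs_O Y)) : Prop :=
  (forall (H : modSheaf (rs_O Y)) (j : modMorph H G),
     (forall U : opens Y, injective (j U)) -> coherent H ->
     finite_set (support H) -> forall (U : opens Y) (h : H U), h = 0) /\
  (exists2 W : opens Y, dense W & iso_on W G (free_mod (rs_O Y) r)).

Definition torsion_free_family (S : ringedSpace) (C : curve_family S)
    (r : nat) (F : modSheaf (rs_O C)) : Prop :=
  [/\ coherent F, flat_over (cf_tau C) F
    & forall s : S, exists Fs : fibre_restriction (cf_fibre C s) F,
        torsion_free_module r Fs].

(* A module structure over O on the quotients F_i / F_(i+1). *)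
Record graded_pieces (X : topologicalType) (F : abSheaf X)
    (Fi : filtration F) (O : ringSheaf X) := GradedPieces {
  gr :> int -> modSheaf O;
  gr_pi : forall i, abMorph (sub_sheaf (Fi i)) (gr i);
  gr_quot : forall i, is_quotient (Fi (i + 1)) (gr_pi i) }.

Record ribbon (S : ringedSpace) := Ribbon {
  rib_C :> curve_family S;
  rib_A : ringSheaf rib_C;
  (* The structure morphism tau^-1 O_S -> A, by adjunction as a morphism
     O_S -> tau_* A. *)
  rib_alg : forall V : opens S,
    {rmorphism rs_O S V -> rib_A (preim_open (rs_cont (cf_tau rib_C)) V)};
  rib_alg_nat : forall (U V : opens S) (h : V `<=` U)
    (h' : preim_open (rs_cont (cf_tau rib_C)) V `<=`
          preim_open (rs_cont (cf_tau rib_C)) U) (b : rs_O S U),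
    rres rib_A h' (rib_alg U b) = rib_alg V (rres (rs_O S) h b);
  rib_fil : filtration rib_A;
  rib_submod : forall (i : int) (V : opens S) (U : opens rib_C)
    (h : U `<=` preim_open (rs_cont (cf_tau rib_C)) V) (b : rs_O S V)
    (a : rib_A U),
    rib_fil i U a -> rib_fil i U (rres rib_A h (rib_alg V b) * a);
  rib_mul : forall (i j : int) (U : opens rib_C) (a b : rib_A U),
    rib_fil i U a -> rib_fil j U b -> rib_fil (i + j) U (a * b);
  rib_one : forall U : opens rib_C, rib_fil 0 U (1 : rib_A U);
  (* pi0 : A_0 -> O_C induces an isomorphism of tau^-1 O_S-algebras
     A_0 / A_1 -> O_C *)
  rib_pi0 : abMorph (sub_sheaf (rib_fil 0)) (rs_O rib_C);
  rib_pi0_quot : is_quotient (rib_fil 1) rib_pi0;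
  rib_pi01 : forall (U : opens rib_C) (c : sub_sec (rib_fil 0) U),
    val c = 1 :> rib_A U -> rib_pi0 U c = 1 :> rs_O rib_C U;
  rib_pi0M : forall (U : opens rib_C) (a b c : sub_sec (rib_fil 0) U),
    val c = val a * val b :> rib_A U ->
    rib_pi0 U c = rib_pi0 U a * rib_pi0 U b :> rs_O rib_C U;
  rib_pi0_alg : forall (V : opens S) (U : opens rib_C)
    (h : U `<=` preim_open (rs_cont (cf_tau rib_C)) V) (b : rs_O S V)
    (c : sub_sec (rib_fil 0) U),
    val c = rres rib_A h (rib_alg V b) ->
    rib_pi0 U c = rres (rs_O rib_C) h (rs_sharp (cf_tau rib_C) V b);
  (* A_i / A_(i+1) is a module over A_0 / A_1 = O_C *)
  rib_gr : graded_pieces rib_fil (rs_O rib_C);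
  rib_grZ : forall (i : int) (U : opens rib_C) (a : sub_sec (rib_fil 0) U)
    (b c : sub_sec (rib_fil i) U),
    val c = val a * val b :> rib_A U ->
    gr_pi rib_gr i U c = (rib_pi0 U a : rs_O rib_C U) *: gr_pi rib_gr i U b;
  rib_tf : forall i, torsion_free_family 1 (rib_gr i);
  rib_exh : exhaustive rib_fil;
  rib_complete : forall i, complete_at rib_fil i }.

Record tf_sheaf (S : ringedSpace) (A : ribbon S) (r : nat) := TfSheaf {
  tf_N :> modSheaf (rib_A A);
  tf_fil : filtration tf_N;
  tf_mul : forall (i j : int) (U : opens A) (n : tf_N U) (a : rib_A A U),
    tf_fil i U n -> rib_fil A j U a -> tf_fil (i + j) U (a *: n);
  tf_gr : graded_pieces tf_fil (rs_O A);
  tf_grZ : forall (i : int) (U : opens A) (a : sub_sec (rib_fil A 0) U)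
    (m n : sub_sec (tf_fil i) U),
    val n = (val a : rib_A A U) *: (val m : tf_N U) ->
    gr_pi tf_gr i U n = (rib_pi0 A U a : rs_O A U) *: gr_pi tf_gr i U m;
  tf_tf : forall i, torsion_free_family r (tf_gr i);
  tf_exh : exhaustive tf_fil;
  tf_complete : forall i, complete_at tf_fil i }.

Definition condition_star2 (S : ringedSpace) (A : ribbon S) : Prop :=
  exists (I : Type) (U : I -> opens A),
    (forall x : A, exists alpha, oset (U alpha) x) /\
    (forall alpha, affine (U alpha) /\
       exists a b : rib_A A (U alpha),
         [/\ rib_fil A 1 (U alpha) a, a * b = 1
           & rib_fil A (-1) (U alpha) b]).

(* Main.v *)
(* The rank n of N_0/N_1 near a point x is r: at a point of the fibre through x
   where the restriction of N_0/N_1 is O^r, the stalk of this restriction has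
   bases of sizes n and r over a nonzero ring.  Lift locally a basis of N_0/N_1
   to sections e_1, ..., e_r of N_0.  The given unit of degree 1 has powers of
   every degree, hence A_k/A_(k+1) = O_C and N_k/N_(k+1) = N_0/N_1 by
   multiplication, so that (c_i) |-> sum c_i e_i maps A_k^r/A_(k+1)^r
   isomorphically onto N_k/N_(k+1), and A_k^r/A_(k+j)^r onto N_k/N_(k+j) by
   induction on j.  Taking limits of sheaves over j, and then the union over k,
   the e_i are a basis of N.  All this is local for isomorphisms of sheaves, so
   no vanishing of cohomology on affines is involved. *)
Require Import Defs.
From HB Require Import structures.
From mathcomp Require Import all_boot all_order all_algebra.
From mathcomp Require Import boolp classical_sets topology.

Set Implicit Arguments.
Unset Strict Implicit.
Unset Printing Implicit Defensive.

Import GRing.Theory Num.Theory.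
Local Open Scope classical_set_scope.
Local Open Scope ring_scope.

(** * Bases of modules over a commutative ring: size and reduction modulo an ideal *)

Definition module_basis (R : comPzRingType) (M : lmodType R) n
    (e : 'I_n -> M) :=
  (forall m : M, exists c : 'I_n -> R, m = \sum_i c i *: e i) /\
  (forall c : 'I_n -> R, \sum_i c i *: e i = 0 -> forall i, c i = 0).

Lemma module_basis_inj (R : comPzRingType) (M : lmodType R) n (e : 'I_n -> M)
    (c d : 'I_n -> R) :
  module_basis e -> \sum_i c i *: e i = \sum_i d i *: e i -> c =1 d.
Proof.
move=> [_ free] /eqP; rewrite -subr_eq0 -sumrB => /eqP cd i.
apply/eqP; rewrite -subr_eq0; apply/eqP; apply: (free (fun i => c i - d i)).
by rewrite -[RHS]cd; apply: eq_bigr => j _; rewrite scalerBl.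
Qed.

Lemma mulmx1_leq (R : comPzRingType) m n (A : 'M[R]_(m, n)) (B : 'M[R]_(n, m)) :
  (1 : R) <> 0 -> A *m B = 1%:M -> (m <= n)%N.
Proof.
move=> /eqP R1.
(* The inequality [mulmx1_min] lives over a nonzero commutative ring, a structure that [R1] puts on
   [R]. *)
pose R' : comNzRingType := HB.pack (GRing.ComPzRing.sort R)
  (GRing.PzSemiRing_isNonZero.Build (GRing.ComPzRing.sort R) R1).
exact: (@mulmx1_min R' m n A B).
Qed.

(** Express [e] through [f] by a matrix [A] and [f] through [e] by [B]. Row [i] of [A B - 1] is a
    relation among the [e_k], because substituting gives [e_i - e_i]. Freeness of [e] yields
    [A B = 1], which bounds [m] by [n]. *)
Lemma module_basis_leq (R : comPzRingType) (M : lmodType R) m n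
    (e : 'I_m -> M) (f : 'I_n -> M) :
  (1 : R) <> 0 -> module_basis e -> module_basis f -> (m <= n)%N.
Proof.
move=> R1 [egen efree] [fgen _].
have [A AP] := choice (fun i => fgen (e i)).
have [B BP] := choice (fun j => egen (f j)).
apply: (@mulmx1_leq R m n (\matrix_(i, j) A i j) (\matrix_(j, i) B j i)) => //.
apply/matrixP => i k; rewrite !mxE; apply/eqP; rewrite -subr_eq0; apply/eqP.
under eq_bigr do rewrite !mxE.
pose c k := \sum_j A i j * B j k - (i == k)%:R.
rewrite -/(c k).
apply: efree; under eq_bigr do rewrite scalerBl scaler_suml.
rewrite sumrB exchange_big /=.
under eq_bigr => j _.
  under eq_bigr do rewrite -scalerA.
  rewrite -scaler_sumr -BP.
  over.
rewrite -AP; apply/eqP; rewrite subr_eq0; apply/eqP.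
rewrite (bigD1 i) //= eqxx scale1r big1 ?addr0 // => j /negPf ji.
by rewrite eq_sym ji scale0r.
Qed.

Lemma module_basis_size (R : comPzRingType) (M : lmodType R) m n
    (e : 'I_m -> M) (f : 'I_n -> M) :
  (1 : R) <> 0 -> module_basis e -> module_basis f -> m = n.
Proof.
move=> R1 eb fb; apply/eqP; rewrite eqn_leq.
by rewrite (module_basis_leq R1 eb fb) (module_basis_leq R1 fb eb).
Qed.

(** Here [R' = R / I R] and [M' = M / I M]. Freeness survives because the coordinates of an element
    of [I M] lie in [I R]: expand in the basis [e] the vectors that are multiplied by elements of
    [I]. *)
Lemma basis_quotient (S R R' : comPzRingType) (phi : S -> R) (I : set S)
    (M : lmodType R) (M' : lmodType R') (theta : R -> R') (pi : M -> M') n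
    (e : 'I_n -> M) :
  (forall b, exists a, theta a = b) ->
  (forall a, theta a = 0 <-> extend_ideal (M := R^o) phi I a) ->
  (forall m', exists m, pi m = m') ->
  (forall m, pi m = 0 <-> extend_ideal phi I m) ->
  {morph pi : m m' / m + m'} -> (forall a m, pi (a *: m) = theta a *: pi m) ->
  module_basis e -> module_basis (fun i => pi (e i)).
Proof.
move=> theta_surj theta_ker pi_surj pi_ker piD piZ eb; have [egen _] := eb.
have pi0 : pi 0 = 0 by apply: (addrI (pi 0)); rewrite -piD !addr0.
have pi_comb c : pi (\sum_i c i *: e i) = \sum_i theta (c i) *: pi (e i).
  by rewrite (big_morph pi piD pi0); apply: eq_bigr => i _.
split=> [m'|c c0 i].
  have [m <-] := pi_surj m'; have [c ->] := egen m.
  by exists (fun i => theta (c i)).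
have [d dE] := choice (fun i => theta_surj (c i)).
have [k [b [m [bI sE]]]] : extend_ideal phi I (\sum_i d i *: e i).
  by apply/pi_ker; rewrite pi_comb -[RHS]c0; apply: eq_bigr => j _; rewrite dE.
have [f fE] := choice (fun j => egen (m j)).
rewrite -dE; apply/theta_ker; exists k, b, (fun j => f j i); split=> //.
apply: (module_basis_inj eb (d := fun i => \sum_j phi (b j) * f j i)).
rewrite sE; under [RHS]eq_bigr do rewrite scaler_suml.
rewrite exchange_big; apply: eq_bigr => j _.
rewrite {1}fE scaler_sumr; apply: eq_bigr => l _.
by rewrite scalerA.
Qed.

(** * Maximal ideals and nonunits of local rings *)

Lemma proper_ideal_maximal (R : comPzRingType) (I : set R) :
  is_ideal I -> ~ I 1 -> exists2 m, maximal_ideal m & I `<=` m.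
Proof.
(* Zorn is applied to sets [J] with [I] united to [J] a proper ideal, rather than to ideals
   containing [I], so that the empty union of the empty chain still qualifies. *)
move=> iI I1; pose P := [set J : set R | is_ideal (I `|` J) /\ ~ (I `|` J) 1].
have [F FP tF|m [[idm m1] mmax]] := @Zorn_bigcup _ P.
- split; last first.
    by case=> // -[J FJ J1]; have [_] := FP _ FJ; apply; right.
  have [I0 ID IM] := iI; split; first by left.
  + have key J a b : F J -> (I `|` J) a -> (I `|` J) b ->
        (I `|` \bigcup_(X in F) X) (a + b).
      move=> FJ Ja Jb; have [[_ D _] _] := FP _ FJ.
      by have [?|?] := D _ _ Ja Jb; [left|right; exists J].
    move=> a b [Ia|[J FJ Ja]] [Ib|[K FK Kb]].
    * by left; apply: ID.
    * by apply: (key K) => //; [left|right].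
    * by apply: (key J) => //; [right|left].
    * have [JK|KJ] := tF _ _ FJ FK.
      - by apply: (key K) => //; right=> //; apply: JK.
      - by apply: (key J) => //; right=> //; apply: KJ.
  + move=> a b [Ib|[J FJ Jb]]; first by left; apply: IM.
    have [[_ _ M] _] := FP _ FJ.
    by have [|?|?] := M a b; [right|left|right; exists J].
- exists (I `|` m); last exact: subsetUl.
  split=> // J iJ J1 ImJ; apply/seteqP; split=> // x Jx.
  apply: contrapT => nx; apply: (mmax J).
    split; first by move=> y my; apply: ImJ; right.
    by move=> Jm; apply: nx; right; apply: Jm.
  suff IJ : I `|` J = J by split; rewrite IJ.
  by apply: setUidr => y Iy; apply: ImJ; left.
Qed.

(** A nonunit generates a proper principal ideal, and the maximal ideal containing it can only be
    [m]. *)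
Lemma local_ring_nonunits (R : comPzRingType) :
  local_ring R -> exists2 m, maximal_ideal m & @nonunits R `<=` m.
Proof.
move=> [m [mmax muniq]]; exists m => // a na.
pose I := [set x | exists b, x = b * a].
have iI : is_ideal I.
  split; first by exists 0; rewrite mul0r.
  - by move=> _ _ [b ->] [c ->]; exists (b + c); rewrite mulrDl.
  - by move=> c _ [b ->]; exists (c * b); rewrite mulrA.
have [|m' m'max Im'] := @proper_ideal_maximal R I iI.
  by case=> b ab; apply: na; exists b; rewrite mulrC.
by rewrite (muniq _ m'max); apply: Im'; exists 1; rewrite mul1r.
Qed.

(** * Restriction, separation and gluing of sections *)

Lemma ares_comp (X : topologicalType) (F : abSheaf X) (U V W : opens X)
    (hVU : V `<=` U) (hWV : W `<=` V) (hWU : W `<=` U) (s : F U) :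
  ares F hWV (ares F hVU s) = ares F hWU s.
Proof. by have [_ rc _] := asheafP F; apply: rc. Qed.

Lemma mres_id (X : topologicalType) (O : ringSheaf X) (F : modSheaf O)
    (U : opens X) (h : U `<=` U) (s : F U) : mres F h s = s.
Proof. by have [ri _ _] := msheafP F; apply: ri. Qed.

Lemma mres_comp (X : topologicalType) (O : ringSheaf X) (F : modSheaf O)
    (U V W : opens X) (hVU : V `<=` U) (hWV : W `<=` V) (hWU : W `<=` U)
    (s : F U) :
  mres F hWV (mres F hVU s) = mres F hWU s.
Proof. by have [_ rc _] := msheafP F; apply: rc. Qed.

Lemma sheaf_sep (X : topologicalType) (F : abSheaf X) (U : opens X)
    (s t : F U) :
  (forall x, oset U x -> exists (V : opens X) (h : V `<=` U),
     oset V x /\ ares F h s = ares F h t) -> s = t.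
Proof.
have [_ rc glue] := asheafP F => loc.
(* The cover consists of all opens on which [s] and [t] agree, so both sections glue the same
   family. *)
pose I := {V : opens X | exists h : V `<=` U, ares F h s = ares F h t}.
pose V (i : I) := sval i.
have hV i : V i `<=` U by case: (svalP i).
have eqV i : ares F (hV i) s = ares F (hV i) t.
  by case: (svalP i) => h; rewrite (Prop_irrelevance (hV i) h).
have [|i j W hi hj|u [_ uu]] := glue I V U hV (fun i => ares F (hV i) s).
- by move=> x /loc [W [h [Wx e]]]; exists (exist _ W (ex_intro _ h e)).
- have hW := subset_trans hi (hV i).
  by rewrite (rc _ _ _ _ _ hW) (rc _ _ _ _ _ hW).
by rewrite -(uu s) // -(uu t).
Qed.

(** The family to be glued is indexed by all local sections satisfying [P]. Local existence thus
    suffices, with no choice of neighbourhoods. *)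
Lemma sheaf_glue (X : topologicalType) (F : abSheaf X) (U : opens X)
    (P : forall V : opens X, set (F V)) :
  (forall (V W W' : opens X) (h : W' `<=` V) (h' : W' `<=` W)
       (s : F V) (t : F W),
     P V s -> P W t -> ares F h s = ares F h' t) ->
  (forall x, oset U x -> exists (V : opens X) (s : F V),
     [/\ V `<=` U, oset V x & P V s]) ->
  exists t : F U, forall (V : opens X) (h : V `<=` U) (s : F V),
    P V s -> ares F h t = s.
Proof.
have [_ rc glue] := asheafP F => uniqP loc.
pose I := {Vs : {V : opens X & F V} | tag Vs `<=` U /\ P (tag Vs) (tagged Vs)}.
pose V (i : I) := tag (sval i).
have hV i : V i `<=` U by case: (svalP i).
have [|i j W hi hj|t [tP _]] := glue I V U hV (fun i => tagged (sval i)).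
- move=> x /loc [W [s [h Wx Ps]]].
  by exists (exist _ (existT (fun V : opens X => F V : Type) W s) (conj h Ps)).
- by apply: uniqP; [case: (svalP i)|case: (svalP j)].
exists t => W h s Ps.
have := tP (exist _ (existT (fun V : opens X => F V : Type) W s) (conj h Ps)).
by move=> /= <-; congr (ares F _ t); apply: Prop_irrelevance.
Qed.

(** * Subsheaves, filtrations and completeness *)

Lemma smemD (X : topologicalType) (F : abSheaf X) (P : subSheaf F) (U : opens X)
    (s t : F U) : P U s -> P U t -> P U (s + t).
Proof.
move=> Ps Pt; rewrite -[t]opprK; apply: smemB => //.
by rewrite -[- t]sub0r; apply: smemB => //; apply: smem0.
Qed.

Lemma smem_sum (X : topologicalType) (F : abSheaf X) (P : subSheaf F)
    (U : opens X) n (s : 'I_n -> F U) :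
  (forall i, P U (s i)) -> P U (\sum_i s i).
Proof.
by move=> Ps; apply: big_ind => //; [apply: smem0 | apply: smemD].
Qed.

Definition to_sub (X : topologicalType) (F : abSheaf X) (P : subSheaf F)
    (U : opens X) (s : F U) (Ps : P U s) : sub_sec P U :=
  Sub s (asboolT Ps).

Lemma fil_le (X : topologicalType) (F : abSheaf X) (Fi : filtration F)
    (i : int) (j : nat) (U : opens X) (s : F U) : Fi (i + j%:Z) U s -> Fi i U s.
Proof.
elim: j => [|j IHj]; first by rewrite addr0.
by rewrite -addn1 PoszD addrA => /fil_desc /IHj.
Qed.

Section Completeness.
Variables (X : topologicalType) (F : abSheaf X) (Fi : filtration F) (i : int).
Hypothesis Fi_complete : complete_at Fi i.

(** Such an [s] has the same image as 0 in every quotient, and a section of the limit is determined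
    by these images. *)
Lemma complete_sep (U : opens X) (s : F U) :
  (forall j : nat, Fi (i + j.+1%:Z) U s) -> s = 0.
Proof.
have [Q [pi [tr [qP trP lim]]]] := Fi_complete => Fs.
have Fis : Fi i U s by apply: (@fil_le _ _ _ _ 1); apply: Fs.
have [|u [_ uu]] := lim U (fun j => 0) _; first by move=> j; rewrite raddf0.
have e0 : u = 0 by apply: uu => j; rewrite raddf0.
have : u = to_sub Fis by apply: uu => j; apply/(qP j).1; apply: Fs.
by rewrite e0 => /(congr1 val).
Qed.

(* P j V holds of local sections of F_i that are well defined modulo
   F_(i+j+1), i.e. it gives a section of the j-th quotient sheaf over U. *)
Lemma complete_glue (U : opens X) (P : nat -> forall V : opens X, set (F V)) :
  (forall j (V : opens X) s, P j V s -> Fi i V s) ->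
  (forall j (V W : opens X) (h : W `<=` V) s, P j V s -> P j W (ares F h s)) ->
  (forall j (V : opens X) s t, P j V s -> P j V t ->
     Fi (i + j.+1%:Z) V (s - t)) ->
  (forall j (V : opens X) s, P j.+1 V s -> P j V s) ->
  (forall j x, oset U x -> exists (V : opens X) (s : F V),
     [/\ V `<=` U, oset V x & P j V s]) ->
  exists s, Fi i U s /\
    forall j (V : opens X) (h : V `<=` U) t, P j V t ->
      Fi (i + j.+1%:Z) V (ares F h s - t).
Proof.
move=> PF Pres Puniq Pdesc Ploc.
have [Q [pi [tr [qP trP lim]]]] := Fi_complete.
have piB j (V : opens X) (s t : sub_sec (Fi i) V) :
    Fi (i + j.+1%:Z) V (val s - val t) -> pi j V s = pi j V t.
  move=> st; apply/eqP; rewrite -subr_eq0 -raddfB; apply/eqP.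
  by apply/(qP j).1.
(* The sections in [P j] agree only modulo a deeper step of the filtration. Their images in [Q j],
   singled out by [R j], agree exactly and therefore glue. *)
pose R j (V : opens X) (q : Q j V) :=
  exists s : sub_sec (Fi i) V, P j V (val s) /\ q = pi j V s.
have glue j : exists q : Q j U,
    forall (V : opens X) (h : V `<=` U) (q' : Q j V),
    R j V q' -> ares (Q j) h q = q'.
  apply: sheaf_glue.
  - move=> V W W' h h' _ _ [s [Ps ->]] [t [Pt ->]].
    rewrite !amap_nat; apply: piB; apply: Puniq; exact: Pres.
  - move=> x /(Ploc j) [V [s [h Vx Ps]]].
    exists V, (pi j V (to_sub (PF _ _ _ Ps))).
    by split=> //; eexists; split; last reflexivity.
pose q j := projT1 (cid (glue j)).
have qE j : forall (V : opens X) (h : V `<=` U) (q' : Q j V),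
  R j V q' -> ares (Q j) h (q j) = q' by rewrite /q; case: cid.
(* Compatibility of the [q j] with the transition maps is local: a section in [P j.+1] also lies in
   [P j] and represents both. *)
have [j|s [sP _]] := lim U q.
  apply: sheaf_sep => x /(Ploc j.+1) [V [s [h Vx Ps]]]; exists V, h; split=> //.
  pose s' := to_sub (PF _ _ _ Ps).
  rewrite amap_nat (qE j.+1 V h (pi j.+1 V s')); last by exists s'.
  by rewrite trP (qE j V h (pi j V s')) //; exists s'; split=> //; apply: Pdesc.
exists (val s); split; first exact: sub_secP.
move=> j V h t Pt; pose t' := to_sub (PF _ _ _ Pt).
have [key _] := (qP j).1 V (ares (sub_sheaf (Fi i)) h s - t'); apply: key.
rewrite raddfB -amap_nat sP (qE j V h (pi j V t')) ?subrr //.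
by exists t'.
Qed.

End Completeness.

(** * Common neighbourhoods and bases of sheaves of modules *)

Lemma common_nbhd (X : topologicalType) (U : opens X) (x : X) n
    (P : 'I_n -> opens X -> Prop) :
  (forall i (V W : opens X), W `<=` V -> P i V -> P i W) ->
  oset U x -> (forall i, exists V : opens X, oset V x /\ P i V) ->
  exists V : opens X, [/\ V `<=` U, oset V x & forall i, P i V].
Proof.
move=> Pmon Ux Ploc.
suff [V [VU Vx PV]] : exists V : opens X,
    [/\ V `<=` U, oset V x & forall i, i \in enum 'I_n -> P i V].
  by exists V; split=> // i; apply: PV; rewrite mem_enum.
elim: (enum _) => [|i s [V [VU Vx PV]]]; first by exists U; split.
have [W [Wx PW]] := Ploc i.
exists (opensI V W); split; [by move=> y [Vy _]; apply: VU|by []|].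
move=> j; rewrite inE => /predU1P[->|/PV Pj].
  by apply: Pmon PW; apply: opensIr.
by apply: Pmon Pj; apply: opensIl.
Qed.

Lemma mres_sum (X : topologicalType) (O : ringSheaf X) (F : modSheaf O)
    (U V W : opens X) (hVU : V `<=` U) (hWV : W `<=` V) (hWU : W `<=` U) n
    (c : 'I_n -> O V) (e : 'I_n -> F U) :
  mres F hWV (\sum_i c i *: mres F hVU (e i)) =
  \sum_i rres O hWV (c i) *: mres F hWU (e i).
Proof.
rewrite raddf_sum; apply: eq_bigr => i _.
by rewrite mresZ (mres_comp _ _ hWU).
Qed.

Definition basis_on (X : topologicalType) (O : ringSheaf X) (F : modSheaf O)
    (V : opens X) n (e : 'I_n -> F V) : Prop :=
  forall (U : opens X) (h : U `<=` V), module_basis (fun i => mres F h (e i)).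

Lemma basis_on_res (X : topologicalType) (O : ringSheaf X) (F : modSheaf O)
    (V U : opens X) (h : U `<=` V) n (e : 'I_n -> F V) :
  basis_on e -> basis_on (fun i => mres F h (e i)).
Proof.
move=> eb W hW; have hWV := subset_trans hW h.
rewrite (_ : (fun i => _) = (fun i => mres F hWV (e i))); first exact: eb.
by apply/funext => i; apply: mres_comp.
Qed.

(** The basis is the preimage of the standard one over [V]; naturality keeps it the preimage of the
    standard basis over every smaller open set. *)
Lemma iso_on_basis (X : topologicalType) (O : ringSheaf X) (F : modSheaf O)
    (V : opens X) n :
  iso_on V F (free_mod O n) -> exists e : 'I_n -> F V, basis_on e.
Proof.
move=> [phi [phi_bij phi_nat]].
have hV : V `<=` V by [].
have [psi phiK psiK] := phi_bij V hV.
pose e i := psi (delta_mx 0 i).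
exists e => U h.
have phiE i : phi U h (mres F h (e i)) = delta_mx 0 i.
  rewrite -(phi_nat V U hV h h) psiK; apply/rowP => j.
  by rewrite !mxE; case: (_ && _); rewrite ?rmorph1 ?rmorph0.
have phi_sum (c : 'I_n -> O U) :
    phi U h (\sum_i c i *: mres F h (e i)) = \row_i c i.
  rewrite linear_sum [RHS]row_sum_delta; apply: eq_bigr => i _.
  by rewrite linearZ /= phiE mxE.
split=> [s|c c0 i].
  exists (fun i => phi U h s 0 i); apply: (bij_inj (phi_bij U h)).
  by rewrite phi_sum; apply/rowP => i; rewrite mxE.
by have := phi_sum c; rewrite c0 linear0 => /rowP/(_ i); rewrite !mxE.
Qed.

Section BasisIso.
Variables (X : topologicalType) (O : ringSheaf X) (F : modSheaf O).
Variables (V : opens X) (n : nat) (e : 'I_n -> F V).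
Hypothesis e_basis : basis_on e.

(** The coefficients are obtained by choice; their uniqueness makes [coord] linear and compatible
    with restriction. *)
Definition coord (U : opens X) (h : U `<=` V) (s : F U) : free_mod O n U :=
  \row_i projT1 (cid ((e_basis h).1 s)) i.

Lemma coordK (U : opens X) (h : U `<=` V) (s : F U) :
  \sum_i (coord h s : 'rV[O U]_n) 0 i *: mres F h (e i) = s.
Proof.
rewrite /coord; case: cid => c /= sE; rewrite [RHS]sE.
by apply: eq_bigr => i _; rewrite mxE.
Qed.

Lemma coord_eq (U : opens X) (h : U `<=` V) (s : F U) (c : 'I_n -> O U) :
  \sum_i c i *: mres F h (e i) = s -> coord h s = \row_i c i.
Proof.
move=> cs; apply/rowP => i; rewrite [RHS]mxE.
by apply: (module_basis_inj (e_basis h)); rewrite coordK.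
Qed.

Lemma coord_is_linear (U : opens X) (h : U `<=` V) : linear (coord h).
Proof.
move=> a s t.
rewrite (@coord_eq U h _ (fun i => a * (coord h s : 'rV_n) 0 i +
  (coord h t : 'rV_n) 0 i)).
  by apply/rowP => i; rewrite !mxE.
rewrite -[in RHS](coordK h s) -[in RHS](coordK h t) scaler_sumr -big_split /=.
by apply: eq_bigr => i _; rewrite scalerDl scalerA.
Qed.

HB.instance Definition _ (U : opens X) (h : U `<=` V) :=
  GRing.isLinear.Build (O U) (F U) (free_mod O n U) *:%R (coord h)
    (coord_is_linear h).

Lemma basis_iso_on : iso_on V F (free_mod O n).
Proof.
exists (fun U h => coord h); split=> [U h|U W hU hW hWU s].
  exists (fun c : 'rV[O U]_n => \sum_i c 0 i *: mres F h (e i)).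
    exact: coordK.
  by move=> c /=; rewrite (coord_eq erefl); apply/rowP => i; rewrite mxE.
rewrite /= -{2}(coordK hU s) (mres_sum _ _ hW) (coord_eq erefl).
by apply/rowP => i; rewrite !mxE.
Qed.

End BasisIso.

(** * Lifting a basis from [N_0/N_1] to [N] in the presence of a unit of degree 1 *)

Section Lifting.
Variables (S : ringedSpace) (A : ribbon S) (r : nat) (N : tf_sheaf A r).
Variables (V : opens A) (n : nat) (e : 'I_n -> sub_sec (tf_fil N 0) V).
Hypothesis gr_basis :
  basis_on (F := tf_gr N 0) (fun i => gr_pi (tf_gr N) 0 V (e i)).
Variables (a b : rib_A A V).
Hypotheses (a1 : rib_fil A 1 V a) (ab1 : a * b = 1) (b1 : rib_fil A (-1) V b).

Local Notation comb h c := (\sum_i c i *: mres N h (val (e i))).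

Lemma unit_of_degree (k : int) : exists u v : rib_A A V,
  [/\ rib_fil A k V u, rib_fil A (- k) V v & v * u = 1].
Proof.
have pw (j : nat) : exists u v : rib_A A V,
    [/\ rib_fil A j%:Z V u, rib_fil A (- j%:Z) V v & v * u = 1].
  elim: j => [|j [u [v [uj vj uv]]]].
    by exists 1, 1; rewrite oppr0 mulr1; split=> //; apply: rib_one.
  exists (a * u), (b * v); split.
  - by rewrite -addn1 addnC PoszD; apply: rib_mul.
  - by rewrite -addn1 addnC PoszD opprD; apply: rib_mul.
  - by rewrite mulrACA uv mulr1 mulrC.
(* For negative [k] the powers of [a] and [b] exchange roles. *)
case: k => j; first exact: pw.
have [u [v [uj vj uv]]] := pw j.+1.
by exists v, u; rewrite NegzE opprK mulrC.
Qed.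

Lemma e_fil0 (W : opens A) (h : W `<=` V) i :
  tf_fil N 0 W (mres N h (val (e i))).
Proof. exact: (smem_res h (sub_secP (e i))). Qed.

Lemma comb_fil (k : int) (W : opens A) (h : W `<=` V) (c : 'I_n -> rib_A A W) :
  (forall i, rib_fil A k W (c i)) -> tf_fil N k W (comb h c).
Proof.
move=> ck; apply: (smem_sum (P := tf_fil N k)) => i.
by rewrite -[k]add0r; apply: tf_mul => //; apply: e_fil0.
Qed.

Lemma comb_scale (W : opens A) (h : W `<=` V) (u : rib_A A W)
    (c : 'I_n -> rib_A A W) :
  comb h (fun i => u * c i) = u *: comb h c.
Proof. by rewrite scaler_sumr; apply: eq_bigr => i _; rewrite scalerA. Qed.

Lemma gr_pi_comb (W : opens A) (h : W `<=` V)
    (c : 'I_n -> sub_sec (rib_fil A 0) W) (s : sub_sec (tf_fil N 0) W) :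
  val s = comb h (fun i => val (c i) : rib_A A W) ->
  gr_pi (tf_gr N) 0 W s =
  \sum_i (rib_pi0 A W (c i) : rs_O A W) *: 
     mres (tf_gr N 0) h (gr_pi (tf_gr N) 0 V (e i)).
Proof.
move=> sE.
have Nce i : tf_fil N 0 W ((val (c i) : rib_A A W) *: mres N h (val (e i))).
  by apply: (@tf_mul _ _ _ N 0 0); [apply: e_fil0|apply: sub_secP].
have -> : s = \sum_i to_sub (Nce i).
  by apply: val_inj; rewrite sE raddf_sum.
rewrite raddf_sum; apply: eq_bigr => i _.
rewrite (tf_grZ (a := c i) (m := ares (sub_sheaf (tf_fil N 0)) h (e i))) //.
by rewrite -(amap_nat (gr_pi (tf_gr N) 0) h).
Qed.

(** Injectivity in degree 0: the class of the combination vanishes in [N_0/N_1], where the [e_i] are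
    free, so each [c_i] dies in [O_C = A_0/A_1]. *)
Lemma comb_fil1 (W : opens A) (h : W `<=` V) (c : 'I_n -> rib_A A W) :
  (forall i, rib_fil A 0 W (c i)) -> tf_fil N 1 W (comb h c) ->
  forall i, rib_fil A 1 W (c i).
Proof.
move=> c0 s1 i; pose c' i := to_sub (c0 i).
have [quotN _] := gr_quot (tf_gr N) 0.
have [_ key] := quotN W (to_sub (comb_fil h c0)).
have := key s1; rewrite (@gr_pi_comb W h c') // => /(gr_basis h).2/(_ i) ci0.
have [quotA _] := rib_pi0_quot A.
by have [+ _] := quotA W (c' i); apply.
Qed.

(** Multiplication by the inverse [v] of a unit of degree [k] moves the question to degree 0;
    multiplying by [u] moves the answer back. *)
Lemma comb_filS (k : int) (W : opens A) (h : W `<=` V) (c : 'I_n -> rib_A A W) :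
  (forall i, rib_fil A k W (c i)) -> tf_fil N (k + 1) W (comb h c) ->
  forall i, rib_fil A (k + 1) W (c i).
Proof.
move=> ck sk i; have [u [v [uk vk vu]]] := unit_of_degree k.
pose u' := rres (rib_A A) h u; pose v' := rres (rib_A A) h v.
have u'k : rib_fil A k W u' := smem_res h uk.
have v'k : rib_fil A (- k) W v' := smem_res h vk.
have vu' : v' * u' = 1 by rewrite -rmorphM vu rmorph1.
have -> : c i = u' * (v' * c i) by rewrite mulrA [u' * _]mulrC vu' mul1r.
apply: rib_mul => //; move: i; apply: (@comb_fil1 _ h) => [i|].
  by rewrite -[0](addNr k); apply: rib_mul.
rewrite comb_scale -[1](addKr k); rewrite addrC.
exact: tf_mul.
Qed.

Lemma comb_filD (k : int) (j : nat) (W : opens A) (h : W `<=` V)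
    (c : 'I_n -> rib_A A W) :
  (forall i, rib_fil A k W (c i)) -> tf_fil N (k + j%:Z) W (comb h c) ->
  forall i, rib_fil A (k + j%:Z) W (c i).
Proof.
elim: j => [|j IHj] ck; first by rewrite addr0.
rewrite -addn1 PoszD addrA => sk i.
apply: (comb_filS (h := h)) => // {i} i.
by apply: IHj => //; apply: fil_desc sk.
Qed.

(** Surjectivity in degree 0. The coefficients in [O_C] exist on all of [W], but lift to [A_0] only
    locally, whence the smaller [W']. *)
Lemma comb_local0 (W : opens A) (h : W `<=` V) (s : N W) x :
  tf_fil N 0 W s -> oset W x ->
  exists (W' : opens A) (hW : W' `<=` W) (hV : W' `<=` V)
    (c : 'I_n -> rib_A A W'),
    [/\ oset W' x, forall i, rib_fil A 0 W' (c i)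
      & tf_fil N 1 W' (mres N hW s - comb hV c)].
Proof.
move=> s0 Wx.
have [c cE] := (gr_basis h).1 (gr_pi (tf_gr N) 0 W (to_sub s0)).
pose P i (W' : opens A) := exists (h' : W' `<=` W)
  (d : sub_sec (rib_fil A 0) W'), rib_pi0 A W' d = rres (rs_O A) h' (c i).
have Pmon i (V1 V2 : opens A) : V2 `<=` V1 -> P i V1 -> P i V2.
  move=> h2 [h1 [d dE]]; exists (subset_trans h2 h1).
  exists (ares (sub_sheaf (rib_fil A 0)) h2 d).
  rewrite -(amap_nat (rib_pi0 A)) dE.
  exact: (ares_comp (F := rs_O A)).
have Ploc i : exists V : opens A, oset V x /\ P i V.
  have [V' [h' [d [V'x dE]]]] := (rib_pi0_quot A).2 W (c i) x Wx.
  by exists V'; split=> //; exists h', d.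
have [W' [hW W'x PW']] := common_nbhd Pmon Wx Ploc.
have hV := subset_trans hW h.
have dex i : exists d : sub_sec (rib_fil A 0) W',
    rib_pi0 A W' d = rres (rs_O A) hW (c i).
  by have [h' [d dE]] := PW' i; exists d; rewrite dE (Prop_irrelevance hW h').
have [d dE] := choice dex.
have d0 i : rib_fil A 0 W' (val (d i)) by apply: sub_secP.
exists W', hW, hV, (fun i => val (d i)); split=> //.
have [quotN _] := gr_quot (tf_gr N) 0.
pose s' := ares (sub_sheaf (tf_fil N 0)) hW (to_sub s0).
have [key _] := quotN W' (s' - to_sub (comb_fil hV d0)); apply: key.
have s'E : gr_pi (tf_gr N) 0 W' s' =
    mres (tf_gr N 0) hW (gr_pi (tf_gr N) 0 W (to_sub s0)).
  by symmetry; apply: (amap_nat (gr_pi (tf_gr N) 0)).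
rewrite raddfB s'E cE (@gr_pi_comb W' hV d) //.
apply/eqP; rewrite subr_eq0; apply/eqP.
etransitivity; first exact: (mres_sum _ _ hV).
by apply: eq_bigr => i _; rewrite dE.
Qed.

Lemma comb_local (k : int) (W : opens A) (h : W `<=` V) (s : N W) x :
  tf_fil N k W s -> oset W x ->
  exists (W' : opens A) (hW : W' `<=` W) (hV : W' `<=` V)
    (c : 'I_n -> rib_A A W'),
    [/\ oset W' x, forall i, rib_fil A k W' (c i)
      & tf_fil N (k + 1) W' (mres N hW s - comb hV c)].
Proof.
move=> sk Wx; have [u [v [uk vk vu]]] := unit_of_degree k.
have vs0 : tf_fil N 0 W (rres (rib_A A) h v *: s).
  rewrite -(subrr k); apply: tf_mul => //; exact: (smem_res h vk).
have [W' [hW [hV [c [W'x c0 cE]]]]] := comb_local0 h vs0 Wx.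
pose u' := rres (rib_A A) hV u.
have u'k : rib_fil A k W' u' := smem_res hV uk.
exists W', hW, hV, (fun i => u' * c i); split=> // [i|].
  by rewrite -[k]addr0; apply: rib_mul.
suff -> : mres N hW s - comb hV (fun i => u' * c i) =
    u' *: (mres N hW (rres (rib_A A) h v *: s) - comb hV c).
  by rewrite addrC; apply: tf_mul.
rewrite comb_scale scalerBr mresZ scalerA.
have -> : rres (rib_A A) hW (rres (rib_A A) h v) = rres (rib_A A) hV v.
  exact: (ares_comp (F := rib_A A)).
by rewrite -rmorphM mulrC vu rmorph1 scale1r.
Qed.

Lemma combD (W : opens A) (h : W `<=` V) (c d : 'I_n -> rib_A A W) :
  comb h (fun i => c i + d i) = comb h c + comb h d.
Proof. by rewrite -big_split; apply: eq_bigr => i _; rewrite scalerDl. Qed.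

Lemma combB (W : opens A) (h : W `<=` V) (c d : 'I_n -> rib_A A W) :
  comb h (fun i => c i - d i) = comb h c - comb h d.
Proof. by rewrite -sumrB; apply: eq_bigr => i _; rewrite scalerBl. Qed.

(** Successive approximation: the error at stage [j] lies in [N_(k+j)] and is corrected, on a
    smaller neighbourhood, by coefficients in [A_(k+j)]. The neighbourhood depends on [j], so no
    limit can be taken at this stage. *)
Lemma comb_localD (k : int) (j : nat) (W : opens A) (h : W `<=` V) (s : N W) x :
  tf_fil N k W s -> oset W x ->
  exists (W' : opens A) (hW : W' `<=` W) (hV : W' `<=` V)
    (c : 'I_n -> rib_A A W'),
    [/\ oset W' x, forall i, rib_fil A k W' (c i)
      & tf_fil N (k + j%:Z) W' (mres N hW s - comb hV c)].
Proof.
move=> sk Wx; elim: j => [|j [W1 [hW1 [hV1 [c1 [W1x c1k c1E]]]]]].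
  exists W, (fun x => id), h, (fun=> 0); split=> // [i|]; first exact: smem0.
  rewrite mres_id addr0 big1 ?subr0 // => i _.
  by rewrite scale0r.
have [W2 [h2 [hV2 [c2 [W2x c2k c2E]]]]] := comb_local hV1 c1E W1x.
have hW2 := subset_trans h2 hW1.
exists W2, hW2, hV2, (fun i => rres (rib_A A) h2 (c1 i) + c2 i).
split=> // [i|].
  apply: (smemD (P := rib_fil A k)); first exact: (smem_res h2 (c1k i)).
  by apply: fil_le (c2k i).
rewrite -addn1 PoszD addrA combD opprD addrA.
by rewrite -(mres_sum hV1 h2 hV2) -(mres_comp hW1 h2 hW2) -raddfB.
Qed.

(** Approximate coefficients are unique modulo [A_(k+j+1)], hence glue over all of [W] for each [j].
    Completeness of [A_k] turns them into true coefficients, and completeness of [N_k] shows that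
    their combination is [s]. *)
Lemma comb_full (k : int) (W : opens A) (h : W `<=` V) (s : N W) :
  tf_fil N k W s -> exists c : 'I_n -> rib_A A W, s = comb h c.
Proof.
move=> sk.
pose R j (W' : opens A) (hW : W' `<=` W) (hV : W' `<=` V)
    (c : 'I_n -> rib_A A W') :=
  (forall i, rib_fil A k W' (c i)) /\
  tf_fil N (k + j.+1%:Z) W' (mres N hW s - comb hV c).
(* [t] is the [i]-th coefficient of some approximation of [s] modulo [N_(k+j+1)]; the shift by one
   matches the indexing of the quotients in [complete_at]. *)
pose P i j (W' : opens A) (t : rib_A A W') :=
  exists hW hV c, R j W' hW hV c /\ c i = t.
have Runiq j W' hW hV hW' hV' c c' : R j W' hW hV c -> R j W' hW' hV' c' ->
    forall i, rib_fil A (k + j.+1%:Z) W' (c i - c' i).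
  move=> [ck cE] [ck' cE']; apply: (@comb_filD _ _ _ hV) => [i|].
    exact: (@smemB _ _ (rib_fil A k) _ _ _).
  rewrite combB (Prop_irrelevance hV hV') in cE *.
  rewrite (Prop_irrelevance hW hW') in cE.
  have -> : comb hV' c - comb hV' c' =
      mres N hW' s - comb hV' c' - (mres N hW' s - comb hV' c) :> N W'.
    by rewrite opprB [RHS]addrC subrKA.
  exact: (@smemB _ _ (tf_fil N (k + j.+1%:Z)) _ _ _ cE' cE).
have Rloc j x : oset W x -> exists W' hW hV c, oset W' x /\ R j W' hW hV c.
  move=> Wx; have [W' [hW [hV [c [W'x ck cE]]]]] := comb_localD j.+1 h sk Wx.
  by exists W', hW, hV, c.
have tP i : exists t : rib_A A W, rib_fil A k W t /\
    forall j (W' : opens A) (hW : W' `<=` W) t', P i j W' t' ->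
      rib_fil A (k + j.+1%:Z) W' (rres (rib_A A) hW t - t').
  apply: (complete_glue (rib_complete A k)).
  - by move=> j W' _ [hW [hV [c [[ck _] <-]]]].
  - move=> j W1 W2 h2 _ [hW [hV [c [[ck cE] <-]]]].
    have hW2 := subset_trans h2 hW; have hV2 := subset_trans h2 hV.
    exists hW2, hV2, (fun i => rres (rib_A A) h2 (c i)); split=> //; split.
      by move=> i'; apply: (smem_res h2 (ck i')).
    have := smem_res h2 cE.
    by rewrite /= raddfB (mres_comp _ _ hW2) (mres_sum _ _ hV2).
  - move=> j W' _ _ [hW [hV [c [cR <-]]]] [hW' [hV' [c' [cR' <-]]]].
    exact: Runiq cR cR' i.
  - move=> j W' _ [hW [hV [c [[ck cE] <-]]]]; exists hW, hV, c; split=> //.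
    split=> //; apply: fil_desc.
    by rewrite -addrA -PoszD addn1.
  - move=> j x /(Rloc j) [W' [hW [hV [c [W'x cR]]]]].
    by exists W', (c i); split=> //; exists hW, hV, c.
have [t {}tP] := choice tP.
exists t; apply/eqP; rewrite -subr_eq0; apply/eqP.
apply: (complete_sep (tf_complete N k)) => j.
apply: smem_local => x /(Rloc j) [W' [hW [hV [c [W'x [ck cE]]]]]].
exists W', hW; split=> //=.
rewrite raddfB (mres_sum _ _ hV).
have -> : mres N hW s - comb hV (fun i => rres (rib_A A) hW (t i)) =
    mres N hW s - comb hV c +
    comb hV (fun i => c i - rres (rib_A A) hW (t i)) :> N W'.
  by rewrite combB [RHS]addrA subrK.
apply: (@smemD _ _ (tf_fil N _)) => //; apply: comb_fil => i.
rewrite -opprB -sub0r.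
apply: (@smemB _ _ (rib_fil A _) _ _ _); first exact: smem0.
by apply: (tP i).2; exists hW, hV, c.
Qed.

(* Locally the c i lie in a common A_k, and then in every A_(k+j). *)
Lemma comb_free (W : opens A) (h : W `<=` V) (c : 'I_n -> rib_A A W) :
  comb h c = 0 -> forall i, c i = 0.
Proof.
move=> c0 i; apply: (sheaf_sep (F := rib_A A)) => x Wx.
pose P i (W' : opens A) := exists (hW : W' `<=` W) (k : int),
  rib_fil A k W' (rres (rib_A A) hW (c i)).
have Pmon i' (V1 V2 : opens A) : V2 `<=` V1 -> P i' V1 -> P i' V2.
  move=> h2 [h1 [k ck]]; exists (subset_trans h2 h1), k.
  rewrite -(ares_comp (F := rib_A A) h1 h2).
  exact: (smem_res h2 ck).
have Ploc i' : exists V : opens A, oset V x /\ P i' V.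
  have [W' [hW [k [W'x ck]]]] := rib_exh (c i') Wx.
  by exists W'; split=> //; exists hW, k.
have [W' [hW W'x PW']] := common_nbhd Pmon Wx Ploc.
exists W', hW; split=> //; rewrite /= raddf0.
have kex i' : exists k, rib_fil A k W' (rres (rib_A A) hW (c i')).
  by have [h' [k ck]] := PW' i'; exists k; rewrite (Prop_irrelevance hW h').
have [k kP] := choice kex.
(* A common lower bound of the finitely many [k i], as the filtration descends. *)
pose k0 : int := - (\sum_i absz (k i))%N%:Z.
have ck0 i' : rib_fil A k0 W' (rres (rib_A A) hW (c i')).
  apply: (@fil_le _ _ _ _ (absz (k i' - k0))); rewrite gez0_abs.
    by rewrite subrKC; apply: kP.
  rewrite opprK (bigD1 i') //= PoszD addrA.
  rewrite addr_ge0 // abszE addrC -[X in _ + X]opprK subr_ge0.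
  by rewrite -normrN ler_norm.
(* The combination is 0, so it lies in every [N_(k0+j+1)]; injectivity puts the coefficients in
   every [A_(k0+j+1)]. *)
apply: (complete_sep (rib_complete A k0)) => j.
have hV := subset_trans hW h.
move: i; apply: (@comb_filD _ _ _ hV) => //.
rewrite -(mres_sum h hW hV) c0 raddf0; exact: smem0.
Qed.

(** A section of [N] lies in some [N_k] only locally, so [comb_full] gives local coefficients;
    [comb_free] makes them agree on overlaps and they glue. *)
Lemma lift_basis : basis_on (fun i => val (e i) : N V).
Proof.
move=> W h; split; last exact: comb_free.
move=> s.
pose P (W' : opens A) (c : free_mod (rib_A A) n W') :=
  exists (hW : W' `<=` W) (hV : W' `<=` V),
    mres N hW s = comb hV (fun i => (c : 'rV_n) 0 i).
have [||c cP] := @sheaf_glue _ (free_mod (rib_A A) n) W P.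
- move=> V1 V2 W' h1 h2 c d [hW1 [hV1 cE]] [hW2 [hV2 dE]].
  have hV := subset_trans h1 hV1; have hW := subset_trans h1 hW1.
  apply/rowP => i; apply/eqP; rewrite -subr_eq0; apply/eqP; move: i.
  apply: (@comb_free _ hV); rewrite combB.
  under eq_bigr do rewrite mxE.
  under [X in _ - X]eq_bigr do rewrite mxE.
  rewrite -(mres_sum hV1 h1 hV) -(mres_sum hV2 h2 hV) -cE -dE.
  by rewrite !(mres_comp _ _ hW) subrr.
- move=> x Wx; have [W1 [h1 [k [W1x sk]]]] := tf_exh s Wx.
  have hV := subset_trans h1 h.
  have [c cE] := comb_full hV sk.
  exists W1, (\row_i c i); split=> //; exists h1, hV.
  by rewrite [LHS]cE; apply: eq_bigr => i _; rewrite mxE.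
exists (fun i => (c : 'rV_n) 0 i).
apply: (sheaf_sep (F := N)) => x Wx.
have [W1 [h1 [k [W1x sk]]]] := tf_exh s Wx.
have hV := subset_trans h1 h.
have [d dE] := comb_full hV sk.
exists W1, h1; split=> //=.
rewrite (mres_sum _ _ hV) [LHS]dE; apply: eq_bigr => i _.
have /rowP/(_ i) : ares (free_mod (rib_A A) n) h1 c = \row_i d i.
  apply: cP; exists h1, hV.
  by rewrite [LHS]dE; apply: eq_bigr => j _; rewrite mxE.
by rewrite !mxE => ->.
Qed.

End Lifting.

(** * Bases of stalks, restriction to fibres, and the rank *)

Lemma mgerm_sum (X : topologicalType) (O : ringSheaf X) (F : modSheaf O)
    (x : X) (U : opens X) (Ux : oset U x) n (s : 'I_n -> F U) :
  mgerm Ux (\sum_i s i) = \sum_i mgerm Ux (s i).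
Proof.
apply: (big_morph (mgerm (F := F) Ux)); last exact: germ0.
by move=> a b; symmetry; apply: (stalk_addE (F := F)).
Qed.

Lemma mgerm_comb (X : topologicalType) (O : ringSheaf X) (F : modSheaf O)
    (x : X) (U V : opens X) (Ux : oset U x) (Vx : oset V x) (h : U `<=` V) n
    (c : 'I_n -> O U) (e : 'I_n -> F V) :
  mgerm Ux (\sum_i c i *: mres F h (e i)) =
  \sum_i rgerm Ux (c i) *: mgerm Vx (e i).
Proof.
rewrite mgerm_sum; apply: eq_bigr => i _.
rewrite -[mgerm Vx (e i)](germ_res (F := F) Vx Ux h).
by symmetry; apply: (mstalk_scaleE (F := F)).
Qed.

Lemma stalk_basis (X : topologicalType) (O : ringSheaf X) (F : modSheaf O)
    (V : opens X) n (e : 'I_n -> F V) (x : X) (Vx : oset V x) :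
  basis_on e -> module_basis (M := mstalk x F) (fun i => mgerm Vx (e i)).
Proof.
move=> eb; split=> [m|c c0].
  have [U [Ux [s ->]]] := stalk_ind m.
  pose W := opensI U V; have Wx : oset W x by split.
  have [c cE] := (eb W (@opensIr _ U V)).1 (mres F (@opensIl _ U V) s).
  exists (fun i => rgerm Wx (c i)).
  rewrite -(mgerm_comb Wx Vx (@opensIr _ U V)) -cE.
  by symmetry; apply: (germ_res (F := F)).
(* Quantifying over all proofs of [oset U x] makes [P] pass to smaller opens, including those that
   miss [x]. *)
pose P i (U : opens X) :=
  forall Ux : oset U x, exists t : O U, c i = rgerm Ux t.
have Pmon i (U W : opens X) : W `<=` U -> P i U -> P i W.
  move=> h PU Wx; have [t ->] := PU (h x Wx); exists (rres O h t).
  by symmetry; apply: (germ_res (F := O)).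
have Ploc i : exists U : opens X, oset U x /\ P i U.
  have [U [Ux [t tE]]] := stalk_ind (c i).
  by exists U; split=> // Ux'; exists t; rewrite tE (Prop_irrelevance Ux Ux').
have [U [h Ux PU]] := common_nbhd Pmon Vx Ploc.
have [t tE] := choice (fun i => PU i Ux).
have : mgerm Ux (\sum_i t i *: mres F h (e i)) = mgerm Ux (0 : F U).
  rewrite (mgerm_comb Ux Vx) [RHS](germ0 F) -[RHS]c0.
  by apply: eq_bigr => i _; rewrite tE.
move=> /(germP (F := F)) [W [hW [hW' [Wx]]]].
have hWV := subset_trans hW h.
rewrite /= (mres_sum h hW hWV) raddf0 => /(eb W hWV).2 tW0 i.
rewrite tE -[LHS](germ_res (F := O) Ux Wx hW) /= tW0.
exact: (germ0 O).
Qed.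

Lemma stalk_hom1 (X Y : ringedSpace) (f : rsMorphism X Y) (x : X) :
  stalk_hom (1 : rstalk (rs_O Y) (f x)) = 1.
Proof.
pose T := opensT Y; have Tx : oset T (f x) by [].
rewrite -[1 in LHS](germ1 (rs_O Y) Tx) /stalk_hom pull_stalkE.
  by rewrite rmorph1; apply: germ1.
by move=> U V h h' s; apply: (rs_sharp_nat h).
Qed.

Section Rank.
Variables (S : ringedSpace) (C : curve_family S).

(** If 1 vanished in the fibre, then 1 would lie in the extension of the maximal ideal at [s] to the
    stalk of [C]. As [tau] is local, that extension lies in the maximal ideal of the stalk. *)
Lemma fibre_stalk_nontrivial (s : S) (y : cf_fibre C s) :
  (1 : rstalk (rs_O (cf_fibre C s)) y) <> 0.
Proof.
set Y := cf_fibre C s; rewrite -(stalk_hom1 (fib_incl Y)) => /fib_ker.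
case=> k [b [m [bN oneE]]].
have [p pmax pN] := local_ring_nonunits ((cf_scheme C).1 (fib_incl Y y)).
have [[p0 pD pM] p1 _] := pmax.
apply: p1; rewrite oneE; apply: big_ind => // i _.
by rewrite [_ *: _]mulrC; apply: pM; apply: pN; apply: cf_local.
Qed.

(** In the fibre through [x] the preimage of [V] is a nonempty open set, so it meets the dense open
    [W] in a point [y]. The two bases are compared there, which need not be over [x]. *)
Lemma torsion_free_rank r (M : modSheaf (rs_O C)) (V : opens C) n
    (e : 'I_n -> M V) (x : C) :
  torsion_free_family r M -> basis_on e -> oset V x -> n = r.
Proof.
move=> [_ _ /(_ (cf_tau C x))[G [_ [W Wd /iso_on_basis[f fb]]]]] eb Vx.
set Y := cf_fibre C (cf_tau C x) in G W Wd f fb.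
have [y [Vy Wy]] : (preim_open (rs_cont (fib_incl Y)) V `&` W) !=set0.
  apply: Wd; last exact: openP.
  have : range (fib_incl Y) x by rewrite fib_im.
  by case=> y _ yx; exists y; rewrite /= yx.
pose z := fib_incl Y y.
pose pi : mstalk z M -> mstalk y G :=
  pull_stalk (F := M) (G := G) (cf := rs_cont (fib_incl Y)) (x := y)
    (fun U => fr_map G U).
have piE (U : opens C) (Uz : oset U z) (m : M U) :
    pi (mgerm Uz m) =
    mgerm (F := G) (U := preim_open (rs_cont (fib_incl Y)) U) Uz (fr_map G U m).
  by apply: pull_stalkE => U1 V1 h h' s; apply: fr_nat.
apply: (module_basis_size (@fibre_stalk_nontrivial _ y) _ (stalk_basis Wy fb)).
apply: (basis_quotient (theta := @stalk_hom _ _ (fib_incl Y) y) (pi := pi)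
  _ _ _ _ _ _ (stalk_basis (x := z) Vy eb)).
- exact: fib_surj.
- exact: fib_ker.
- exact: fr_surj.
- exact: fr_ker.
- move=> m m'; have [U [Uz [s [t [-> ->]]]]] := stalk_ind2 m m'.
  rewrite [_ + _ in LHS](stalk_addE (F := M)).
  rewrite [LHS]piE raddfD [LHS](esym (stalk_addE (F := G) _ _ _)).
  by congr (_ + _); symmetry; apply: piE.
- move=> a m; have [U [Uz [s [t [-> ->]]]]] := stalk_ind2 a m.
  rewrite [_ *: _ in LHS](mstalk_scaleE (F := M)) [LHS]piE fr_mapZ.
  rewrite [LHS](esym (mstalk_scaleE (F := G) _ _ _)).
  congr (_ *: _); last by symmetry; apply: piE.
  rewrite /stalk_hom pull_stalkE // => U1 V1 h h' u.
  exact: (rs_sharp_nat h).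
Qed.

End Rank.

(** * Construction of a basis of [N] near a point *)

Theorem proposition1 (S : ringedSpace) (hS : noetherian_scheme S)
  (A : ribbon S) (hA : condition_star2 A)
  (r : nat) (N : tf_sheaf A r)
  (hN : locally_free (tf_gr N 0%R)) :
  locally_free_of_rank N r.
Proof.
move=> x.
have [V0 V0x [n /iso_on_basis[f0 f0b]]] := hN x.
have nr : n = r := torsion_free_rank (tf_tf N 0) f0b V0x.
move: f0 f0b; rewrite {n}nr => f0 f0b.
have [I [U [Ucov UP]]] := hA.
have [alpha Ux] := Ucov x.
have [_ [a [b [a1 ab1 b1]]]] := UP alpha.
pose V1 := opensI V0 (U alpha).
have V1x : oset V1 x by split.
have h0 : V1 `<=` V0 := @opensIl _ _ _.
have hU : V1 `<=` U alpha := @opensIr _ _ _.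
(* [N_0 -> N_0/N_1] is surjective only locally, so each [f0 i] lifts on its own neighbourhood of
   [x]; finitely many of these are intersected. *)
pose P i (W : opens A) := exists (h : W `<=` V0) (e : sub_sec (tf_fil N 0) W),
  gr_pi (tf_gr N) 0 W e = mres (tf_gr N 0) h (f0 i).
have Pmon i (W W' : opens A) : W' `<=` W -> P i W -> P i W'.
  move=> h [hW [e eE]]; exists (subset_trans h hW).
  exists (ares (sub_sheaf (tf_fil N 0)) h e).
  by rewrite -(amap_nat (gr_pi (tf_gr N) 0)) eE; apply: mres_comp.
have Ploc i : exists W : opens A, oset W x /\ P i W.
  have [W [h [e [Wx eE]]]] := (gr_quot (tf_gr N) 0).2 V0 (f0 i) x V0x.
  by exists W; split=> //; exists h, e.
have [V [hV Vx PV]] := common_nbhd Pmon V1x Ploc.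
have hV0 := subset_trans hV h0; have hVU := subset_trans hV hU.
have eex i : exists e : sub_sec (tf_fil N 0) V,
    gr_pi (tf_gr N) 0 V e = mres (tf_gr N 0) hV0 (f0 i).
  by have [h [e eE]] := PV i; exists e; rewrite eE (Prop_irrelevance h hV0).
have [e eE] := choice eex.
exists V => //; apply: (@basis_iso_on _ _ _ _ _ (fun i => val (e i))).
apply: (@lift_basis _ _ _ _ _ _ _ _
  (rres (rib_A A) hVU a) (rres (rib_A A) hVU b)).
- by rewrite (_ : (fun i => _) = (fun i => mres (tf_gr N 0) hV0 (f0 i)));
    [apply: basis_on_res | apply/funext].
- exact: (smem_res hVU a1).
- by rewrite -rmorphM ab1 rmorph1.
- exact: (smem_res hVU b1).
Qed.
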